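(* Let $\alpha\in(0,1)$ be irrational with principal convergents $p_i/q_i$, and let $\delta_i=|\alpha-p_i/q_i|$, $\beta_i=\delta_i^{-1}$. Let $n$ be a positive integer with $n>1/\alpha$ and $n>1/(1-\alpha)$, and let $\lambda=\mathrm{sh}(w(n,\alpha))$. Let $h\ge0$ be such that $\beta_{2h}\le n<\beta_{2h+2}$, put $*=0$ if $\beta_{2h}\le n<\beta_{2h+1}$ and $*=2$ if $\beta_{2h+1}\le n<\beta_{2h+2}$, let $$x_0:=\frac{1-n\delta_{2h+1}}{q_{2h+*}(\delta_{2h+*}-\delta_{2h+1})},$$ and define the piecewise linear function $$L(n,\alpha;x)=\begin{cases} q_{2h+*}(1+n\delta_{2h+*})-2q_{2h+*}^2\delta_{2h+*}\,x & \text{for } 0\le x\le x_0,\\[4pt] \dfrac{q_{2h+1}(1+n\delta_{2h+1})-x}{2q_{2h+1}^2\delta_{2h+1}} & \text{for } x_0\le x\le q_{2h+1}(1+n\delta_{2h+1}).\end{cases}$$ Then $$\mathrm{dist}\left(L(n,\alpha;x),\partial A_\lambda\right)<8\qquad\text{for all } 0\le x\le q_{2h+1}(1+n\delta_{2h+1}).$$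
   Context: The principal convergents of $\alpha=[a_0;a_1,a_2,\ldots]$ (simple continued fraction) are the reduced fractions $p_k/q_k=[a_0;a_1,\ldots,a_k]$, $k\ge 0$; since $\alpha\in(0,1)$, $a_0=0$ and $p_0/q_0=0/1$. Let $f(i)=\alpha i-\lfloor \alpha i\rfloor$. The permutation $w(n,\alpha)\in S_n$ is the sorting permutation of $(f(1),\ldots,f(n))$, i.e. the permutation $w$ with $f(w(1))<\cdots<f(w(n))$. For $w\in S_n$, $\mathrm{sh}(w)$ denotes the common shape of the two standard Young tableaux associated with $w$ by Schensted insertion (the Robinson–Schensted correspondence), viewed as a partition $\lambda=(\lambda_1\ge\cdots\ge\lambda_m>0)$ of $n$. Equivalently (Greene's theorem), $\lambda_1+\cdots+\lambda_k$ is the maximal size of a union of $k$ increasing subsequences of $w$. The planar set of $\lambda$ is $A_\lambda=\bigcup_{1\le k\le m,\ 1\le l\le\lambda_k}[l-1,l]\times[k-1,k]\subset\mathbb{R}^2$, and $\partial A_\lambda$ denotes the part of its topological boundary lying strictly in the first quadrant (i.e. not on a coordinate axis). For fixed $x$, $\mathrm{dist}(L(n,\alpha;x),\partial A_\lambda)$ is the minimum (infimum) Euclidean distance from the point $(x,L(n,\alpha;x))$ to a point of $\partial A_\lambda$. *)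

(* Defs.v *)
From HB Require Import structures.
From mathcomp Require Import all_boot all_order all_algebra all_fingroup.
From mathcomp Require Import all_classical all_reals all_analysis.

Set Implicit Arguments.
Unset Strict Implicit.
Unset Printing Implicit Defensive.

Import Order.TTheory GRing.Theory Num.Theory.
Import numFieldNormedType.Exports.
Local Open Scope classical_set_scope.
Local Open Scope ring_scope.

Section ContinuedFraction.
Variable R : realType.
Implicit Types (alpha : R) (k i n h : nat).

Fixpoint complete_quotient alpha k : R :=
  if k is k'.+1 then
    let y := complete_quotient alpha k' in (y - (Num.floor y)%:~R)^-1
  else alpha.

Definition partial_quotient alpha k : int :=
  Num.floor (complete_quotient alpha k).

(* [a; s_0, s_1, ...] = a + 1 / (s_0 + 1 / (s_1 + ...)) *)
Fixpoint cfrac (a : int) (s : seq int) : rat :=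
  if s is b :: s' then a%:~R + (cfrac b s')^-1 else a%:~R.

Definition convergent alpha k : rat :=
  cfrac (partial_quotient alpha 0)
        [seq partial_quotient alpha j | j <- iota 1 k].

(* p_k / q_k is the convergent in lowest terms with q_k > 0. *)
Definition conv_num alpha k : int := numq (convergent alpha k).
Definition conv_den alpha k : int := denq (convergent alpha k).

Definition conv_err alpha k : R :=
  `|alpha - (conv_num alpha k)%:~R / (conv_den alpha k)%:~R|.

Definition conv_beta alpha k : R := (conv_err alpha k)^-1.

End ContinuedFraction.

Section SortingPermutation.
Variables (R : realType) (n : nat).
Implicit Types (f : nat -> R).

(* Positions and values 1, ..., n are represented by 0, ..., n-1 in 'I_n. *)
Definition sorted_indices f : seq 'I_n :=
  sort (fun i j : 'I_n => f i.+1 <= f j.+1) (enum 'I_n).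

Lemma sorting_fun_inj f : injective (fun i : 'I_n => nth i (sorted_indices f) i).
Proof.
have sz : size (sorted_indices f) = n by rewrite size_sort size_enum_ord.
move=> i j; rewrite (set_nth_default i j) ?sz ?ltn_ord // => /eqP.
rewrite nth_uniq ?sz ?ltn_ord ?sort_uniq ?enum_uniq //.
by move=> /eqP/val_inj.
Qed.

Definition sorting_perm f : 'S_n := perm (@sorting_fun_inj f).

Lemma sorting_permP f :
  (forall i j : 'I_n, f i.+1 = f j.+1 -> i = j) ->
  forall i j : 'I_n, (i < j)%N ->
    f (sorting_perm f i).+1 < f (sorting_perm f j).+1.
Proof.
move=> finj i j ij.
have sz : size (sorted_indices f) = n by rewrite size_sort size_enum_ord.
rewrite lt_neqAle; apply/andP; split.
  apply/eqP => /finj /perm_inj eij.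
  by rewrite eij ltnn in ij.
rewrite !permE /= (set_nth_default i j) ?sz ?ltn_ord //.
have le_tr : transitive (fun i j : 'I_n => f i.+1 <= f j.+1).
  by move=> x y z; apply: le_trans.
have le_refl : reflexive (fun i j : 'I_n => f i.+1 <= f j.+1).
  by move=> x; apply: lexx.
have srt : sorted (fun i j : 'I_n => f i.+1 <= f j.+1) (sorted_indices f).
  by apply: sort_sorted => x y; apply: le_total.
by apply: (sorted_leq_nth le_tr le_refl _ srt); rewrite ?inE ?sz ?ltn_ord ?(ltnW ij).
Qed.

End SortingPermutation.

Definition frac_mul (R : realType) (alpha : R) (i : nat) : R :=
  alpha * i%:R - (Num.floor (alpha * i%:R))%:~R.

Definition kronecker_perm (R : realType) (n : nat) (alpha : R) : 'S_n :=
  sorting_perm n (frac_mul alpha).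

Section Schensted.

(* Insert x in an increasing row: the first entry larger than x, if any, is
   replaced by x and returned. *)
Fixpoint row_insert (x : nat) (r : seq nat) : option nat * seq nat :=
  if r is y :: r' then
    if (x < y)%N then (Some y, x :: r')
    else let: (b, r'') := row_insert x r' in (b, y :: r'')
  else (None, [:: x]).

Fixpoint tableau_insert (x : nat) (t : seq (seq nat)) : seq (seq nat) :=
  if t is r :: t' then
    let: (b, r') := row_insert x r in
    if b is Some y then r' :: tableau_insert y t' else r' :: t'
  else [:: [:: x]].

Definition insertion_tableau (s : seq nat) : seq (seq nat) :=
  foldl (fun t x => tableau_insert x t) [::] s.

(* The recording tableau has by construction the shape of the insertion
   tableau, so only the latter is needed. *)
Definition sh (n : nat) (w : 'S_n) : seq nat :=
  shape (insertion_tableau [seq (w i).+1 | i <- enum 'I_n]).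

End Schensted.

Section Planar.
Variable R : realType.

Definition planar_set (la : seq nat) : set (R * R) :=
  \bigcup_(k in [set k | (1 <= k <= size la)%N])
  \bigcup_(l in [set l | (1 <= l <= nth 0%N la k.-1)%N])
    (`[l%:R - 1, l%:R] `*` `[k%:R - 1, k%:R]).

Definition planar_boundary (la : seq nat) : set (R * R) :=
  (closure (planar_set la) `\` interior (planar_set la)) `&`
  [set z | 0 < z.1 /\ 0 < z.2].

Definition euclid_dist (z t : R * R) : R :=
  Num.sqrt ((z.1 - t.1) ^+ 2 + (z.2 - t.2) ^+ 2).

(* Extended-real valued, so that the distance to the empty set is +oo. *)
Definition dist_to (z : R * R) (A : set (R * R)) : \bar R :=
  ereal_inf [set (euclid_dist z t)%:E | t in A].

End Planar.

Section LimitShape.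
Variable R : realType.
Implicit Types (alpha x : R) (n h : nat).

Local Notation q alpha k := ((conv_den alpha k)%:~R : R).
Local Notation delta alpha k := (conv_err alpha k).

(* The even index 2h + *, given beta_{2h} <= n < beta_{2h+2}. *)
Definition even_index n alpha h : nat :=
  if n%:R < conv_beta alpha (2 * h + 1) then (2 * h + 0)%N else (2 * h + 2)%N.

Definition x_break n alpha h : R :=
  let e := even_index n alpha h in
  let o := (2 * h + 1)%N in
  (1 - n%:R * delta alpha o) / (q alpha e * (delta alpha e - delta alpha o)).

Definition x_max n alpha h : R :=
  let o := (2 * h + 1)%N in
  q alpha o * (1 + n%:R * delta alpha o).

(* The two branches agree at x_break because adjacent convergents satisfy
   q_e * q_o * (delta_e + delta_o) = 1. *)
Definition L_fun n alpha h x : R :=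
  let e := even_index n alpha h in
  let o := (2 * h + 1)%N in
  if x <= x_break n alpha h then
    q alpha e * (1 + n%:R * delta alpha e) -
      2 * q alpha e ^+ 2 * delta alpha e * x
  else
    (q alpha o * (1 + n%:R * delta alpha o) - x) /
      (2 * q alpha o ^+ 2 * delta alpha o).

End LimitShape.

(* Main.v *)
Require Import Defs.
From mathcomp Require Import all_boot all_order all_algebra all_fingroup.
From mathcomp Require Import all_classical all_reals all_analysis.
From mathcomp Require Import zify ring lra.

(** The points [(i, f i)], [0 < i <= n], are the points in a box [n] wide and
    [1] high of the plane lattice spanned by [(1, alpha)] and [(0, 1)].  Take
    consecutive convergents with [beta_k <= n < beta_(k+1)].  Write [q], [q']
    for their denominators, [e = q delta_k], [e' = q' delta_(k+1)], and flip
    the vertical axis when [k] is odd.  A reduced basis of the lattice is then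
    [u = (q, e)], [v = (q', - e')], of area [q' e + q e' = 1]: a step along
    [u] rises and a step along [v] falls.  So lines in direction [u] cut the
    permutation into increasing sequences, those in direction [v] into
    decreasing ones (the other way round when the axis is flipped).  By
    Greene's theorem the shape can be read off from the largest unions of
    such sequences.

    Greene.  The largest size of a union of [k] increasing (or decreasing)
    subsequences does not change under a Knuth move ([k_chains_knuth]), and
    row insertion is a composition of Knuth moves ([row_bump_chains]).  One
    may therefore replace the word by the reading word of its insertion
    tableau, where an increasing class meets each column at most once and a
    decreasing class meets each row at most once.  This bounds such unions by
    the first [k] rows, respectively the first [k] columns
    ([greene_increasing], [greene_decreasing]).

    Columns.  Take [k] even; for odd [k] increasing and decreasing sequences,
    and rows and columns, trade places.  Let [F X] be the size of the first [X]
    columns, [G j] that of the first [j] rows, and [M X] the sum of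
    [min (len b) X] over the lines [b] in direction [u], [len b] being the
    number of points on [b].  The lines with at least [X] points are increasing sequences, and the elementary inequality
    [F X + G j <= n + j X] between column sums and row sums turns this into
    [F X <= M X].  Conversely, for [X <= x0], choose on each line a window of
    [X] consecutive lattice points, so that the window moves little from a
    line to the next; points at the same offset in their windows then form a
    decreasing sequence ([offset_class_decreasing]), and these [X] sequences
    cover [min (len b) X] points of every line as soon as each window either
    lies in the box or contains all box points of its line ([windows]).  Hence
    [F X = M X], and column [X] has height the number of lines with at least
    [X] points.  Up to [1] this is the range of lines that have room for [X]
    points in the box, of width [W X = q + n e - 2 q e X]: one linear
    piece of [L] ([column_upper], [column_lower]).

    Rows.  Turning the picture by a quarter turn exchanges [(q, q')] with
    [(e', e)] and rows with columns, so the same lemmas give the other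
    linear piece.

    Distance.  Both slopes are at most [2] in absolute value when measured
    along the axis on which the piece is a column (or row) estimate, so near
    every point of the graph of [L] there are a cell corner and a point not
    covered by the shape, each within [1] in one coordinate and [4] in the
    other ([near_cell], [near_hole]).  The segment that joins them meets the
    boundary of the shape, at distance at most [sqrt 17 < 8]. *)

Set Implicit Arguments.
Unset Strict Implicit.
Unset Printing Implicit Defensive.

Import Order.TTheory GRing.Theory Num.Theory.
Import numFieldNormedType.Exports.
Local Open Scope classical_set_scope.
Local Open Scope ring_scope.

(** * Unions of chains in a word *)
Section Chains.
Local Open Scope nat_scope.

(** The [k] chains are the colour classes of colours below [k]; the other
    letters are the uncovered ones.  A colouring keeps the chains disjoint, and
    makes a move of letters a change of colours only. *)
Definition k_chains (r : rel nat) (k : nat) (w : seq nat) (m : nat) : Prop :=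
  exists2 c : nat -> nat,
    (forall j, j < k -> sorted r [seq x <- w | c x == j]) &
    m <= count (fun x => c x < k) w.

Lemma k_chains_rev r k w m :
  k_chains r k w m -> k_chains (fun x y => r y x) k (rev w) m.
Proof.
case=> c Hc Hm; exists c; last by rewrite count_rev.
by move=> j jk; rewrite filter_rev rev_sorted; apply: Hc.
Qed.

Lemma k_chains_revK r k w m :
  k_chains (fun x y => r y x) k (rev w) m -> k_chains r k w m.
Proof. by move/k_chains_rev; rewrite revK. Qed.

Lemma filter_swap (p : pred nat) u x z v : ~~ (p x && p z) ->
  [seq a <- u ++ [:: x, z & v] | p a] = [seq a <- u ++ [:: z, x & v] | p a].
Proof. by rewrite !filter_cat /=; case: (p x); case: (p z). Qed.

Lemma count_swap (p : pred nat) u x z v :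
  count p (u ++ [:: x, z & v]) = count p (u ++ [:: z, x & v]).
Proof. by rewrite !count_cat /=; lia. Qed.

Variables (r : rel nat) (r_tr : transitive r) (r_irr : irreflexive r).

Let r_asym x y : r x y -> r y x = false.
Proof. by move=> xy; apply/negP => /(r_tr xy); rewrite r_irr. Qed.

Lemma k_chains_swap k (u v : seq nat) (x z m : nat) (c : nat -> nat) :
  (forall j, j < k -> sorted r [seq a <- u ++ [:: x, z & v] | c a == j]) ->
  m <= count (fun a : nat => c a < k) (u ++ [:: x, z & v]) ->
  (c x < k -> c x = c z -> False) ->
  k_chains r k (u ++ [:: z, x & v]) m.
Proof.
move=> Hc Hm H; exists c; last by rewrite count_swap.
move=> j jk; rewrite -filter_swap; first exact: Hc.
by apply/negP => /andP[/eqP cx /eqP cz]; apply: H; rewrite cx // cz.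
Qed.

(** A chain never holds both letters of an adjacent inversion, so undoing the
    inversion breaks none. *)
Lemma k_chains_descent k (u v : seq nat) (x z m : nat) : r x z ->
  k_chains r k (u ++ [:: z, x & v]) m -> k_chains r k (u ++ [:: x, z & v]) m.
Proof.
move=> xz [c Hc Hm]; apply: (k_chains_swap Hc Hm) => cz ezx.
have := Hc _ cz; rewrite filter_cat /= ezx eqxx => /cat_sorted2[_] /=.
by rewrite r_asym.
Qed.

Let sorted_rcons_le (s : seq nat) x y :
  r x y -> sorted r (rcons s x) -> sorted r (rcons s y).
Proof.
case: s => [//|a s] xy /=; rewrite !rcons_path => /andP[-> /=].
by move/r_tr; apply.
Qed.

Let swap_eq (i j a b : nat) :
  ((if a == i then j else if a == j then i else a) == b) =
  (a == (if b == i then j else if b == j then i else b)).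
Proof.
by case: (altP (a =P i)); case: (altP (a =P j));
   case: (altP (b =P i)); case: (altP (b =P j)); lia.
Qed.

(** The exchange of [x] and [z] only harms a chain that contains both, say
    [A x z B].  The witness [y] between them repairs it: if [y] is uncovered,
    use [A y z B]; if [y] lies in another chain [C y D], exchange the initial
    parts and use [C y z B] and [A x D].  The number of covered letters does
    not change. *)
Lemma k_chains_knuth k (u v : seq nat) (x y z m : nat) : uniq (u ++ [:: y, x, z & v]) ->
  r x y -> r y z ->
  k_chains r k (u ++ [:: y, x, z & v]) m ->
  k_chains r k (u ++ [:: y, z, x & v]) m.
Proof.
move=> Uw xy yz [c Hc Hm].
have [/andP[cxk /eqP cxz]|] := boolP ((c x < k) && (c x == c z)); last first.
  move=> nc; rewrite -cat_rcons; rewrite -cat_rcons in Hc Hm.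
  apply: (k_chains_swap Hc Hm) => cxk e.
  by rewrite cxk e eqxx in nc.
set i := c x in cxk cxz; set j := c y.
have [xu yu zu] : [/\ x \notin u, y \notin u & z \notin u].
  move: Uw; rewrite cat_uniq => /and3P[_ /hasPn H _].
  by split; apply: H; rewrite !inE eqxx ?orbT.
have [yx yz' yv xz' xv] :
    [/\ y != x, y != z, y \notin v, x != z & x \notin v].
  move: Uw; rewrite cat_uniq => /and3P[_ _] /=.
  rewrite !inE !negb_or => /andP[/and3P[-> -> ->]].
  by move=> /andP[/andP[-> ->] _].
have uv (a : nat) : a \in v -> a \notin u.
  move=> av; move: Uw; rewrite cat_uniq => /and3P[_ /hasPn H _].
  by apply: H; rewrite !inE av !orbT.
have nij : j != i.
  apply/eqP => eji; have := Hc _ cxk.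
  rewrite filter_cat /= -/i -/j eji eqxx => /cat_sorted2[_] /=.
  by rewrite r_asym.
have Hi := Hc _ cxk; move: Hi.
rewrite filter_cat /= -/i -/j -cxz (negbTE nij) !eqxx sorted_cat_cons /=.
case/and3P=> ui_x xz z_vi.
(* [i] is the colour of [x] and [z], [j] that of [y]; in the first case [y] is
   uncovered. *)
have [jk|jk] := ltnP j k; last first.
  pose c' (a : nat) := if a == x then j else if a == y then i else c a.
  have c'E (a : nat) : a != x -> a != y -> c' a = c a.
    by rewrite /c' => /negbTE-> /negbTE->.
  have c'u (a : nat) : a \in u -> c' a = c a.
    by move=> au; apply: c'E; apply: contraTneq au => ->.
  have c'v (a : nat) : a \in v -> c' a = c a.
    by move=> au; apply: c'E; apply: contraTneq au => ->.
  have c'x : c' x = j by rewrite /c' eqxx.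
  have c'y : c' y = i by rewrite /c' (negbTE yx) eqxx.
  have c'z : c' z = i by rewrite c'E // eq_sym.
  exists c'; last first.
    apply: leq_trans Hm _; rewrite !count_cat /= c'x c'y c'z -/i -/j -cxz.
    rewrite (eq_in_count (a1 := fun a : nat => c' a < k) (a2 := fun a : nat => c a < k)) => [|a /c'u /= ->//].
    rewrite (eq_in_count (s := v) (a1 := fun a : nat => c' a < k) (a2 := fun a : nat => c a < k)) => [|a /c'v /= ->//].
    move: (count _ u) (count _ v) (i < k) (j < k) => U V I J.
    by rewrite !(addnCA (nat_of_bool J)).
  move=> l lk; rewrite filter_cat /= c'x c'y c'z.
  rewrite (eq_in_filter (a2 := fun a : nat => c a == l)) => [|a /c'u /= ->//].
  rewrite (eq_in_filter (s := v) (a2 := fun a : nat => c a == l)) => [|a /c'v /= ->//].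
  have jl : (j == l) = false.
    by apply/negbTE; apply: contraTneq lk => <-; rewrite -leqNgt.
  rewrite jl.
  have := Hc _ lk; rewrite filter_cat /= -/i -/j -cxz.
  rewrite jl.
  have [<-|//] := eqVneq i l.
  by rewrite !sorted_cat_cons /= => _; rewrite (sorted_rcons_le xy) //= yz.
have Hj := Hc _ jk; move: Hj.
rewrite filter_cat /= -/i -/j -cxz eqxx (eq_sym i) (negbTE nij).
rewrite sorted_cat_cons => /andP[uj_y y_vj].
(* [sw] exchanges the two colours; it is applied to the letters before [y]. *)
pose sw a := if a == i then j else if a == j then i else a.
have sw_eq (a b : nat) : (sw a == b) = (a == sw b) by apply: swap_eq.
pose c' (a : nat) := if a == x then j else if a == y then i
  else if a \in u then sw (c a) else c a.
have c'u (a : nat) : a \in u -> c' a = sw (c a).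
  move=> au; rewrite /c' au.
  have /negbTE-> : a != x by apply: contraTneq au => ->.
  by have /negbTE-> : a != y by apply: contraTneq au => ->.
have c'v (a : nat) : a \in v -> c' a = c a.
  move=> au; rewrite /c' (negbTE (uv _ au)).
  have /negbTE-> : a != x by apply: contraTneq au => ->.
  by have /negbTE-> : a != y by apply: contraTneq au => ->.
have c'x : c' x = j by rewrite /c' eqxx.
have c'y : c' y = i by rewrite /c' (negbTE yx) eqxx.
have c'z : c' z = i.
  by rewrite /c' eq_sym (negbTE xz') eq_sym (negbTE yz') (negbTE zu).
exists c'; last first.
  apply: leq_trans Hm _; rewrite !count_cat /= c'x c'y c'z -/i -/j -cxz.
  rewrite (eq_in_count (a1 := fun a : nat => c' a < k) (a2 := fun a : nat => c a < k)) => [|a /c'u /= ->]; last first.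
    rewrite /sw; case: ifP => [/eqP->|_]; first by rewrite jk cxk.
    by case: ifP => [/eqP->|//]; rewrite jk cxk.
  rewrite (eq_in_count (s := v) (a1 := fun a : nat => c' a < k) (a2 := fun a : nat => c a < k)) => [|a /c'v /= ->//].
  move: (count _ u) (count _ v) (i < k) (j < k) => U V I J.
  by rewrite !(addnCA (nat_of_bool J)).
move=> l lk; rewrite filter_cat /= c'x c'y c'z.
rewrite (eq_in_filter (a2 := fun a : nat => c a == sw l)) => [|a /c'u /= ->]; last first.
  by rewrite sw_eq.
rewrite (eq_in_filter (s := v) (a2 := fun a : nat => c a == l)) => [|a /c'v /= ->//].
have [<-|il] := eqVneq i l.
  rewrite (negbTE nij) /sw eqxx sorted_cat_cons /= yz z_vi.
  by rewrite uj_y.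
have [<-|jl] := eqVneq j l.
  by rewrite /sw eqxx (negbTE nij) sorted_cat_cons ui_x (path_le r_tr xy).
have := Hc _ lk; rewrite filter_cat /= -/i -/j -cxz /sw (negbTE il) (negbTE jl).
by rewrite eq_sym (negbTE il) eq_sym (negbTE jl).
Qed.

End Chains.

(** * Invariance under row insertion *)
Section Greene.
Local Open Scope nat_scope.

Lemma sorted_rcons2 (s : seq nat) (c y : nat) :
  sorted ltn (rcons (rcons s c) y) = sorted ltn (rcons s c) && (c < y).
Proof. by rewrite -!cats1 -catA /= sorted_cat_cons /= andbT cats1. Qed.

Definition same_chains (w w' : seq nat) : Prop :=
  forall k m, (k_chains ltn k w m <-> k_chains ltn k w' m) /\
              (k_chains gtn k w m <-> k_chains gtn k w' m).

Lemma same_chains_sym w w' : same_chains w w' -> same_chains w' w.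
Proof. by move=> H k m; have [[? ?] [? ?]] := H k m. Qed.

Lemma same_chains_trans w1 w2 w3 :
  same_chains w1 w2 -> same_chains w2 w3 -> same_chains w1 w3.
Proof.
move=> H1 H2 k m; have [h1 g1] := H1 k m; have [h2 g2] := H2 k m.
by split; [apply: iff_trans h1 h2|apply: iff_trans g1 g2].
Qed.

Let gtn_trans : transitive gtn.
Proof. by move=> y x z /= yx zy; apply: ltn_trans yx. Qed.

Let gtn_irr : irreflexive gtn. Proof. by move=> x /=; rewrite ltnn. Qed.

Lemma uniq_swap (u v : seq nat) (x z : nat) :
  uniq (u ++ [:: x, z & v]) = uniq (u ++ [:: z, x & v]).
Proof.
by apply: perm_uniq; rewrite perm_cat2l -(cat1s x) -(cat1s z) perm_catCA.
Qed.

Lemma same_chains_knuth_middle_first (u v : seq nat) (x y z : nat) :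
  uniq (u ++ [:: y, x, z & v]) -> x < y -> y < z ->
  same_chains (u ++ [:: y, x, z & v]) (u ++ [:: y, z, x & v]).
Proof.
move=> U xy yz k m; have xz := ltn_trans xy yz; split; split.
- exact: (k_chains_knuth ltn_trans ltnn U xy yz).
- rewrite -!(cat_rcons y u).
  exact: (k_chains_descent ltn_trans ltnn xz).
- rewrite -!(cat_rcons y u).
  exact: (k_chains_descent (r := gtn) gtn_trans gtn_irr).
- apply: (k_chains_knuth (r := gtn) gtn_trans gtn_irr) => //.
  by rewrite -cat_rcons uniq_swap cat_rcons.
Qed.

Lemma same_chains_rev w w' :
  same_chains (rev w) (rev w') -> same_chains w w'.
Proof.
move=> H k m; have [Hl Hg] := H k m; split; split => h.
- by apply: (k_chains_revK (r := ltn)); apply/Hg; apply: (k_chains_rev (r := ltn)).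
- by apply: (k_chains_revK (r := ltn)); apply/Hg; apply: (k_chains_rev (r := ltn)).
- by apply: (k_chains_revK (r := gtn)); apply/Hl; apply: (k_chains_rev (r := gtn)).
- by apply: (k_chains_revK (r := gtn)); apply/Hl; apply: (k_chains_rev (r := gtn)).
Qed.

(** Reversing the words exchanges increasing and decreasing chains, and the two
    kinds of Knuth moves. *)
Lemma same_chains_knuth_middle_last (u v : seq nat) (x y z : nat) :
  uniq (u ++ [:: x, z, y & v]) -> x < y -> y < z ->
  same_chains (u ++ [:: x, z, y & v]) (u ++ [:: z, x, y & v]).
Proof.
move=> U xy yz; have U' : uniq (rev v ++ [:: y, z, x & rev u]).
  by rewrite -rev_uniq rev_cat revK !rev_cons revK -!cats1 -!catA.
have U'' : uniq (rev v ++ [:: y, x, z & rev u]).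
  by rewrite -cat_rcons uniq_swap cat_rcons.
apply: same_chains_rev; rewrite !rev_cat !rev_cons -!cats1 -!catA /=.
by apply: same_chains_sym; apply: same_chains_knuth_middle_first.
Qed.

(** The letter [t] just after [y] is between [y] and its left neighbour, so it
    witnesses their exchange; this neighbour then plays the role of [t]. *)
Lemma bumped_moves_left (u a v : seq nat) (y t : nat) :
  uniq (u ++ a ++ [:: y, t & v]) -> sorted ltn (rcons a t) -> t < y ->
  same_chains (u ++ a ++ [:: y, t & v]) (u ++ y :: a ++ t :: v).
Proof.
elim/last_ind: a t v => [//|a c IH] t v U st ty.
have [ct sac] : c < t /\ sorted ltn (rcons a c).
  by move: st; rewrite sorted_rcons2 => /andP[-> ->].
rewrite cat_rcons in U *.
apply: same_chains_trans (_ : same_chains _ (u ++ a ++ [:: y, c, t & v])) _.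
  by rewrite !catA; apply: same_chains_knuth_middle_last; rewrite // -catA.
rewrite (cat_rcons c a); apply: IH => //; last exact: ltn_trans ct ty.
by rewrite catA -uniq_swap -catA.
Qed.

(** The letter to the left of the neighbour [c] of [x] is between [x] and [c],
    so it witnesses their exchange; [y] is the last such witness. *)
Lemma inserted_moves_left (u b v : seq nat) (x y : nat) :
  uniq (u ++ y :: b ++ x :: v) -> path ltn y b -> x < y ->
  same_chains (u ++ y :: b ++ x :: v) (u ++ [:: y, x & b ++ v]).
Proof.
elim/last_ind: b v => [//|b c IH] v U.
rewrite rcons_path => /andP[pb lc] xy; rewrite cat_rcons in U *.
apply: same_chains_trans (_ : same_chains _ (u ++ y :: b ++ [:: x, c & v])) _.
  have xl : x < last y b.
    have := pb; rewrite path_sortedE; last exact: ltn_trans.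
    case/lastP: (b) => [//|b' d] /andP[/allP/(_ d)].
    by rewrite mem_rcons inE eqxx last_rcons => /(_ isT) yd _; apply: ltn_trans xy yd.
  have e w : u ++ y :: b ++ w = (u ++ belast y b) ++ last y b :: w.
    by rewrite -cat_cons lastI cat_rcons catA.
  rewrite !e in U *; apply: same_chains_sym; apply: same_chains_knuth_middle_first => //.
  by rewrite -cat_rcons uniq_swap cat_rcons.
rewrite (cat_rcons c b); apply: IH => //; move: U; rewrite -!(cat_cons y) !catA.
by rewrite uniq_swap.
Qed.

Variant row_insert_spec (x : nat) (r : seq nat) : option nat * seq nat -> Type :=
| RowBump a y b of r = a ++ y :: b & all (geq x) a & x < y :
    row_insert_spec x r (Some y, a ++ x :: b)
| RowAppend of all (geq x) r : row_insert_spec x r (None, rcons r x).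

Lemma row_insertP x r : row_insert_spec x r (row_insert x r).
Proof.
elim: r => [|z r IH] /=; first by constructor.
case: ltnP => [xz|zx]; first exact: (RowBump (a := [::])).
case: IH => [a y b -> ax xy|rx].
- by apply: (RowBump (a := z :: a)) => //=; rewrite zx.
- by rewrite -rcons_cons; constructor; rewrite /= zx.
Qed.

(** Inserting [x] in the row [a y b] turns the word [a y b x] into [y a x b]:
    [x] travels left over [b], then [y] over [a]. *)
Lemma row_bump_chains (u a b v : seq nat) (x y : nat) :
  uniq (u ++ (a ++ y :: b) ++ x :: v) -> sorted ltn (a ++ y :: b) ->
  all (geq x) a -> x < y ->
  same_chains (u ++ (a ++ y :: b) ++ x :: v) (u ++ y :: (a ++ x :: b) ++ v).
Proof.
move=> U srt ax xy.
have := srt; rewrite sorted_cat_cons => /andP[say pb].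
have sax : sorted ltn (rcons a x).
  case/lastP: a ax say U {srt} => [//|a c] ax say U.
  move: say; rewrite !sorted_rcons2 => /andP[-> _] /=.
  have : c <= x by move/allP: ax; apply; rewrite mem_rcons inE eqxx.
  rewrite leq_eqVlt => /predU1P[cx|//]; move: U; rewrite cat_uniq => /and3P[_ _].
  by rewrite cat_uniq => /and3P[_ /hasPn/(_ x)]; rewrite inE eqxx cx !cat_rcons mem_cat inE eqxx orbT => /(_ isT).
have e : u ++ (a ++ y :: b) ++ x :: v = (u ++ a) ++ y :: b ++ x :: v.
  by rewrite -!catA.
have U' := U; rewrite e in U' *.
apply: same_chains_trans (_ : same_chains _ ((u ++ a) ++ [:: y, x & b ++ v])) _.
  exact: inserted_moves_left.
rewrite -!catA /=; apply: bumped_moves_left => //.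
move: U'; rewrite -catA; congr is_true; apply: perm_uniq.
by rewrite !perm_cat2l perm_cons -(cat1s x v) -(cat1s x (b ++ v)) perm_catCA.
Qed.

End Greene.

(** * The insertion tableau *)
Section Tableaux.
Local Open Scope nat_scope.

(** The rows are read from the bottom one to the first, so that a letter bumped
    from a row is met before the rest of this row. *)
Definition reading (t : seq (seq nat)) : seq nat := flatten (rev t).

Lemma reading_cons r t : reading (r :: t) = reading t ++ r.
Proof. by rewrite /reading rev_cons flatten_rcons. Qed.

Definition row_above (r1 r2 : seq nat) : bool :=
  (size r2 <= size r1) &&
  all (fun j => nth 0 r1 j < nth 0 r2 j) (iota 0 (size r2)).

Fixpoint is_tableau (t : seq (seq nat)) : bool :=
  if t is r :: t' then
    [&& sorted ltn r, row_above r (head [::] t') & is_tableau t']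
  else true.

Lemma row_aboveP r1 r2 :
  reflect (size r2 <= size r1 /\ forall j, j < size r2 -> nth 0 r1 j < nth 0 r2 j)
          (row_above r1 r2).
Proof.
apply: (iffP andP) => -[s H]; split=> //.
  by move=> j jr; apply: (allP H); rewrite mem_iota.
by apply/allP => j; rewrite mem_iota => /H.
Qed.

Lemma nth_mid (a b : seq nat) x y j :
  nth 0 (a ++ x :: b) j = if j == size a then x else nth 0 (a ++ y :: b) j.
Proof.
rewrite !nth_cat; case: ltngtP => //= [ja|->]; last by rewrite subnn.
by rewrite -(subnKC ja) addSn subSn ?leq_addr // addnC addnK.
Qed.

(** The bumped letter [y] lands in [r2] weakly to the left of its old column,
    since the entry of [r2] in that column, if any, exceeds [y]; and up to that
    column the new upper row is at most [x < y]. *)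
Lemma row_bump_above (a b r2 : seq nat) x y :
  row_above (a ++ y :: b) r2 -> sorted ltn (a ++ x :: b) -> x < y ->
  row_above (a ++ x :: b) (row_insert y r2).2.
Proof.
move=> /row_aboveP[s12 H12] sx xy.
have szE : size (a ++ x :: b) = size (a ++ y :: b) by rewrite !size_cat.
have sx' : sorted leq (a ++ x :: b) by apply: sub_sorted sx => ? ? /ltnW.
have ax j : j <= size a -> nth 0 (a ++ x :: b) j < y.
  move=> ja; apply: leq_ltn_trans xy.
  have {2}-> : x = nth 0 (a ++ x :: b) (size a) by rewrite nth_cat ltnn subnn.
  apply: (sorted_leq_nth leq_trans leqnn 0 sx') => //; rewrite inE size_cat /=.
    by rewrite addnS ltnS (leq_trans ja) // leq_addr.
  by rewrite addnS ltnS leq_addr.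
have xy_nth j : j < size r2 -> nth 0 (a ++ x :: b) j < nth 0 r2 j.
  move=> jr; apply: leq_ltn_trans (H12 _ jr); rewrite (nth_mid _ _ _ y).
  by case: eqP => // ->; rewrite nth_cat ltnn subnn /= ltnW.
have small a2 c2 : r2 = a2 ++ c2 -> all (geq y) a2 -> size a2 <= size a.
  move=> r2E a2y; rewrite leqNgt; apply/negP => aa2.
  have /H12 : size a < size r2 by rewrite r2E size_cat (leq_trans aa2) ?leq_addr.
  rewrite r2E !nth_cat ltnn subnn aa2 /= ltnNge => /negP; apply.
  by apply: (allP a2y); apply: mem_nth.
case: row_insertP => [a2 z b2 r2E a2y yz|r2y] /=; apply/row_aboveP.
  rewrite szE; split=> [|j jr]; first by move: s12; rewrite r2E !size_cat.
  have sz2 : size r2 = size (a2 ++ y :: b2) by rewrite r2E !size_cat.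
  rewrite (nth_mid a2 b2 y z) -r2E; case: eqP => [->|_]; last first.
    by apply: xy_nth; rewrite sz2.
  exact/ax/(small _ _ r2E).
have ra : size r2 <= size a by apply: (small _ [::]); rewrite ?cats0.
split=> [|j]; first by rewrite size_rcons size_cat /= addnS ltnS (leq_trans ra) ?leq_addr.
rewrite size_rcons ltnS leq_eqVlt => /predU1P[->|jr].
  by rewrite nth_rcons ltnn eqxx; apply: ax.
by rewrite nth_rcons jr; apply: xy_nth.
Qed.

Lemma head_tableau_insert y t :
  head [::] (tableau_insert y t) = (row_insert y (head [::] t)).2.
Proof. by case: t => [//|r t] /=; case: row_insert => -[z|]. Qed.

Lemma tableau_insertP t x v :
  is_tableau t -> uniq (reading t ++ x :: v) ->
  [/\ is_tableau (tableau_insert x t),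
      same_chains (reading t ++ x :: v) (reading (tableau_insert x t) ++ v) &
      perm_eq (reading t ++ x :: v) (reading (tableau_insert x t) ++ v)].
Proof.
elim: t x v => [|r t IH] x v /=.
  by move=> _ _; split.
case/and3P=> sr rt tt; rewrite reading_cons -catA => U.
have xr : x \notin r.
  by move: U; rewrite cat_uniq => /and3P[_ _]; rewrite cat_uniq /= negb_or => /and3P[_ /andP[]].
have lt_of_all s : all (geq x) s -> {subset s <= r} -> all (gtn x) s.
  move=> /allP sx sr'; apply/allP => z zs /=.
  rewrite ltn_neqAle (sx _ zs : z <= x) andbT.
  by apply: contraNneq xr => <-; apply: sr'.
case: row_insertP => [a y b rE ax xy|ax] /=.
  have a_x : all (gtn x) a by apply: lt_of_all => // z za; rewrite rE mem_cat za.
  move: sr; rewrite rE sorted_cat_cons => /andP[say pyb].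
  have srx : sorted ltn (a ++ x :: b).
    rewrite sorted_cat_cons (path_le ltn_trans xy) // andbT.
    case/lastP: (a) say a_x => [//|a' c]; rewrite all_rcons.
    by rewrite !sorted_rcons2 => /andP[-> _] /andP[].
  have U' : uniq (reading t ++ y :: (a ++ x :: b) ++ v).
    move: U; rewrite rE; congr is_true; apply: perm_uniq.
    rewrite perm_cat2l -!catA /= -(cat1s y (b ++ _)) perm_catCA /= perm_cons.
    by rewrite perm_cat2l -(cat1s x v) -(cat1s x (b ++ v)) perm_catCA.
  have [tt' ch pm] := IH _ _ tt U'.
  split.
  - apply/and3P; split=> //; rewrite head_tableau_insert.
    by apply: row_bump_above => //; rewrite -rE.
  - rewrite reading_cons -(catA (reading (tableau_insert y t))).
    apply: same_chains_trans ch.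
    by rewrite rE in U *; apply: row_bump_chains => //; rewrite sorted_cat_cons say.
  - rewrite reading_cons -(catA (reading (tableau_insert y t))).
    apply: perm_trans pm.
    rewrite perm_cat2l -!catA /= -(cat1s y (b ++ _)) perm_catCA /= perm_cons.
    by rewrite perm_cat2l -(cat1s x v) -(cat1s x (b ++ v)) perm_catCA.
have a_x : all (gtn x) r by apply: lt_of_all.
rewrite !reading_cons -!catA cat_rcons tt andbT; split=> //.
apply/andP; split.
  case/lastP: (r) sr a_x => [//|a' c]; rewrite all_rcons.
  by rewrite sorted_rcons2 => -> /andP[].
apply/row_aboveP; move/row_aboveP: rt => [s H].
split=> [|j jr]; first by rewrite size_rcons ltnW.
by rewrite nth_rcons (leq_trans jr s) H.
Qed.

Lemma insertion_tableauP w : uniq w ->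
  [/\ is_tableau (insertion_tableau w),
      same_chains w (reading (insertion_tableau w)) &
      perm_eq w (reading (insertion_tableau w))].
Proof.
suff H t : is_tableau t -> uniq (reading t ++ w) ->
    [/\ is_tableau (foldl (fun t x => tableau_insert x t) t w),
      same_chains (reading t ++ w)
        (reading (foldl (fun t x => tableau_insert x t) t w)) &
      perm_eq (reading t ++ w)
        (reading (foldl (fun t x => tableau_insert x t) t w))].
  by move=> U; apply: (H [::]).
elim: w t => [|x w IH] t tt U /=; first by rewrite cats0; split.
have [tt' ch pm] := tableau_insertP tt U.
have [|t2 c2 p2] := IH _ tt'; first by rewrite -(perm_uniq pm).
by split=> //; [apply: same_chains_trans c2|apply: perm_trans p2].
Qed.

End Tableaux.

(** * Greene's bounds *)
Section GreeneBounds.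
Local Open Scope nat_scope.

Lemma tableau_rows t i1 i2 : is_tableau t -> i1 < i2 -> i2 < size t ->
  row_above (nth [::] t i1) (nth [::] t i2).
Proof.
elim: t i1 i2 => [//|r t IH] i1 [//|i2] /= /and3P[sr rt tt] i12 i2t.
case: i1 i12 => [_|i1 i12]; last by apply: IH.
elim: i2 i2t => [|i IHi] it; first by case: (t) it rt.
have /row_aboveP[s1 h1] := IHi (ltnW it).
have /row_aboveP[s2 h2] := IH i i.+1 tt (ltnSn _) it.
apply/row_aboveP; split=> [|j js]; first exact: leq_trans s1.
by apply: ltn_trans (h2 _ js); apply: h1; apply: leq_trans s2.
Qed.

Lemma shape_tableau_sorted t : is_tableau t -> sorted geq (shape t).
Proof.
elim: t => [//|r [//|r' t] IH] /= /and3P[_ /andP[s _] tt].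
by rewrite s; apply: IH.
Qed.

(** A lower row is read earlier, so an increasing class has its smaller letters
    in the lower rows, whereas columns increase downwards. *)
Lemma reading_row_order t (c : nat -> nat) l i1 i2 a b :
  sorted ltn [seq x <- reading t | c x == l] -> i1 < i2 ->
  a \in nth [::] t i2 -> b \in nth [::] t i1 -> c a = l -> c b = l -> a < b.
Proof.
elim: t i1 i2 => [|r t IH] i1 i2; first by rewrite !nth_nil.
rewrite reading_cons filter_cat (sorted_pairwise ltn_trans) pairwise_cat.
rewrite -!(sorted_pairwise ltn_trans) => /and3P[ab st _].
case: i2 => [//|i2] i12 a2 b1 ca cb.
case: i1 => [|i1] in i12 b1; last exact: (IH i1 i2).
apply: (allrelP ab); rewrite mem_filter ?ca ?cb eqxx //=.
apply/flattenP; exists (nth [::] t i2) => //; rewrite mem_rev mem_nth //.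
by rewrite ltnNge; apply/negP => h; rewrite /= nth_default in a2.
Qed.

Lemma count_reading (p : pred nat) t :
  count p (reading t) = \sum_(i < size t) count p (nth [::] t i).
Proof.
elim: t => [|r t IH] /=; first by rewrite big_ord0.
by rewrite reading_cons count_cat IH big_ord_recl addnC.
Qed.

Lemma count_columns (p : pred nat) r W : size r <= W ->
  count p r = \sum_(j < W) ((j < size r) && p (nth 0 r j)).
Proof.
elim: r W => [|a r IH] W /=; first by move=> _; rewrite big1.
case: W => [//|W] sW; rewrite big_ord_recl /= (IH W) //.
Qed.

Lemma sum_ord_lt m k : k <= m -> \sum_(i < m) (i < k) = k.
Proof.
move=> km; transitivity (\sum_(i < k) 1); last by rewrite sum_nat_const card_ord muln1.
by rewrite (big_ord_widen _ (fun=> 1) km) [RHS]big_mkcond; apply: eq_bigr => i _; case: ifP.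
Qed.

(** Column [j] meets each class at most once, so it has at most [k] coloured
    cells, and it has no more of them than its height. *)
Lemma column_bound (m k : nat) (s : nat -> nat) (T : nat -> nat) (j : nat)
    (c : nat -> nat) :
  (forall i1 i2, i1 < i2 -> i2 < m -> s i2 <= s i1) ->
  (forall i1 i2, i1 < i2 -> i2 < m -> j < s i2 -> c (T i1) < k ->
     c (T i1) != c (T i2)) ->
  \sum_(i < m) ((j < s i) && (c (T i) < k)) <= \sum_(i < m) ((i < k) && (j < s i)).
Proof.
move=> s_mono c_inj.
have [/existsP[i0 /andP[ki0 ji0]]|/existsPn noi] :=
  boolP [exists i0 : 'I_m, (k <= i0) && (j < s i0)]; last first.
  apply: leq_sum => i _; have := noi i; rewrite negb_and -ltnNge.
  by case: (i < k) => /= [_|/negbTE->//]; case: (j < s i); case: (_ < k).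
have -> : \sum_(i < m) ((i < k) && (j < s i)) = k.
  rewrite (eq_bigr (fun i : 'I_m => nat_of_bool (i < k))) => [|i _].
    have km : k <= m by rewrite ltnW // (leq_ltn_trans ki0).
    exact: sum_ord_lt.
  case: ltnP => //= ik; rewrite (leq_trans ji0) //.
  by apply: s_mono; rewrite // (leq_trans ik).
set I := [pred i : 'I_m | (j < s i) && (c (T i) < k)].
have -> : \sum_(i < m) ((j < s i) && (c (T i) < k)) = #|I|.
  by rewrite -sum1_card [RHS]big_mkcond; apply: eq_bigr => i _; rewrite inE; case: ifP.
rewrite cardE -(size_map (fun i : 'I_m => c (T i))).
rewrite -[X in _ <= X](size_iota 0); apply: uniq_leq_size.
  rewrite map_inj_in_uniq ?enum_uniq // => i1 i2.
  rewrite !mem_enum => /andP[j1 c1] /andP[j2 c2] e.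
  apply/val_inj/eqP; case: ltngtP => // h.
    by have := c_inj _ _ h (ltn_ord _) j2 c1; rewrite e eqxx.
  by have := c_inj _ _ h (ltn_ord _) j1 c2; rewrite e eqxx.
move=> x /mapP[i]; rewrite mem_enum => /andP[_ ck] ->.
by rewrite mem_iota.
Qed.

Lemma sumn_take_ord (la : seq nat) k :
  sumn (take k la) = \sum_(i < size la) (i < k) * nth 0 la i.
Proof.
elim: la k => [|x l IH] [|k] //=; rewrite ?big_ord0 //.
  by rewrite big1.
by rewrite big_ord_recl IH mul1n.
Qed.

Lemma tableau_increasing t k (c : nat -> nat) : is_tableau t ->
  (forall j, j < k -> sorted ltn [seq x <- reading t | c x == j]) ->
  count (fun x => c x < k) (reading t) <= sumn (take k (shape t)).
Proof.
move=> tt cs; pose s i := size (nth [::] t i); pose W := s 0.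
have s_mono i1 i2 : i1 < i2 -> i2 < size t -> s i2 <= s i1.
  by move=> i12 i2t; have /row_aboveP[] := tableau_rows tt i12 i2t.
have sW i : i < size t -> s i <= W by case: i => // i; apply: s_mono.
have -> : sumn (take k (shape t)) = \sum_(i < size t) \sum_(j < W) ((i < k) && (j < s i)).
  rewrite sumn_take_ord size_map; apply: eq_bigr => i _.
  have -> : nth 0 (shape t) i = s i by rewrite (nth_map [::]).
  case: (i < k); last by rewrite mul0n big1.
  by rewrite mul1n sum_ord_lt // sW.
rewrite count_reading (eq_bigr (fun i : 'I_(size t) =>
  \sum_(j < W) ((j < s i) && (c (nth 0 (nth [::] t i) j) < k)))) => [|i _]; last first.
  by apply: count_columns; apply: sW.
rewrite exchange_big [X in _ <= X]exchange_big; apply: leq_sum => j _.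
apply: (column_bound (T := fun i => nth 0 (nth [::] t i) j)) => //.
move=> i1 i2 i12 i2t js ck; apply/eqP => e.
have /row_aboveP[s12 h12] := tableau_rows tt i12 i2t.
have := reading_row_order (cs _ ck) i12 (mem_nth 0 js)
  (mem_nth 0 (leq_trans js s12)) (esym e) erefl.
by rewrite ltnNge ltnW // h12.
Qed.

(** A row of the tableau is an increasing factor of the reading word, so it
    meets a decreasing class at most once. *)
Lemma tableau_decreasing t k (c : nat -> nat) : is_tableau t ->
  (forall j, j < k -> sorted gtn [seq x <- reading t | c x == j]) ->
  count (fun x => c x < k) (reading t) <= \sum_(l <- shape t) minn l k.
Proof.
elim: t => [|r t IH] tt cs; first by rewrite big_nil.
rewrite reading_cons count_cat big_cons addnC leq_add //; last first.
  apply: IH => [|j jk]; first by case/and3P: tt.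
  by have := cs j jk; rewrite reading_cons filter_cat => /cat_sorted2[].
rewrite leq_min count_size /= -size_filter -(size_map c) -[X in _ <= X](size_iota 0).
apply: uniq_leq_size => [|x /mapP[a]]; last first.
  by rewrite mem_filter mem_iota => /andP[ck _] ->.
have sr : sorted ltn r by case/and3P: tt.
rewrite map_inj_in_uniq ?filter_uniq ?(sorted_uniq ltn_trans ltnn) //.
move=> a b; rewrite !mem_filter => /andP[ca ar] /andP[_ br] e.
have := cs _ ca; rewrite reading_cons filter_cat => /cat_sorted2[_].
have sub : sorted ltn [seq x <- r | c x == c a] by apply: sorted_filter sr; apply: ltn_trans.
have : a \in [seq x <- r | c x == c a] by rewrite mem_filter eqxx.
have : b \in [seq x <- r | c x == c a] by rewrite mem_filter e eqxx.
case: [seq x <- r | c x == c a] sub => [//|x [|y l]] /=.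
  by rewrite !inE => _ /eqP-> /eqP->.
by move=> /andP[xy _] _ _ /andP[yx _]; move: yx; rewrite /= ltnNge ltnW.
Qed.

Lemma greene_increasing w k (c : nat -> nat) : uniq w ->
  (forall j, j < k -> sorted ltn [seq x <- w | c x == j]) ->
  count (fun x => c x < k) w <= sumn (take k (shape (insertion_tableau w))).
Proof.
move=> U cs; have [tt ch _] := insertion_tableauP U.
have [[+ _] _] := ch k (count (fun x => c x < k) w).
case=> [|c' cs' le]; first by exists c.
exact: leq_trans le (tableau_increasing tt cs').
Qed.

Lemma greene_decreasing w k (c : nat -> nat) : uniq w ->
  (forall j, j < k -> sorted gtn [seq x <- w | c x == j]) ->
  count (fun x => c x < k) w <= \sum_(l <- shape (insertion_tableau w)) minn l k.
Proof.
move=> U cs; have [tt ch _] := insertion_tableauP U.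
have [_ [+ _]] := ch k (count (fun x => c x < k) w).
case=> [|c' cs' le]; first by exists c.
exact: leq_trans le (tableau_decreasing tt cs').
Qed.

Lemma shape_insertion w : uniq w ->
  sorted geq (shape (insertion_tableau w)) /\
  sumn (shape (insertion_tableau w)) = size w.
Proof.
move=> U; have [tt _ pm] := insertion_tableauP U.
split; first exact: shape_tableau_sorted.
by rewrite (perm_size pm) size_flatten /shape map_rev sumn_rev.
Qed.

End GreeneBounds.

(** * Column sums and row sums of a partition *)
Section PartialSums.
Local Open Scope nat_scope.
Implicit Types (la : seq nat) (x y k : nat).

Definition colsum la x : nat := \sum_(l <- la) minn l x.
Definition rowsum la k : nat := sumn (take k la).

(** The first [x] columns and the first [k] rows have at most [k * x] cells in
    common. *)
Lemma colsum_rowsum la x k : colsum la x + rowsum la k <= sumn la + k * x.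
Proof.
rewrite /colsum /rowsum; elim: la k => [|l la IH] k.
  by rewrite big_nil.
rewrite big_cons; case: k => [|k] /=.
  have := IH 0; rewrite take0 /=; have := geq_minl l x; lia.
have := IH k; have := geq_minr l x; lia.
Qed.

Lemma colsumS la x : colsum la x.+1 = colsum la x + count (ltn x) la.
Proof.
rewrite /colsum; elim: la => [|l la IH]; rewrite ?big_nil // !big_cons IH /=.
by case: (ltnP x l) => h; lia.
Qed.

Lemma rowsumS la k : rowsum la k.+1 = rowsum la k + nth 0 la k.
Proof.
rewrite /rowsum; case: (ltnP k (size la)) => h.
  by rewrite (take_nth 0 h) sumn_rcons.
by rewrite nth_default // addn0 !take_oversize // ltnW.
Qed.

Lemma cellE la x y : sorted geq la -> (x < nth 0 la y) = (y < count (ltn x) la).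
Proof.
have geq_trans : transitive geq by move=> b a c ab bc; apply: leq_trans bc ab.
elim: la y => [|l la IH] y; first by rewrite nth_nil.
rewrite /= path_sortedE // => /andP[lla sla].
have [xl|lx] := ltnP x l.
  by case: y => [|y] /=; rewrite ?xl // IH.
have -> : count (ltn x) la = 0.
  apply/eqP; rewrite -leqn0 leqNgt -has_count; apply/hasPn => z zla /=.
  by rewrite -leqNgt (leq_trans _ lx) //; apply: (allP lla).
case: y => [|y] /=; first by rewrite ltnNge lx.
rewrite ltn0; apply/negbTE; rewrite -leqNgt.
have [yla|yla] := ltnP y (size la); last by rewrite nth_default.
by rewrite (leq_trans _ lx) //; apply: (allP lla); rewrite mem_nth.
Qed.

End PartialSums.

(** * The shape of a sorting permutation *)
Section SortedWord.
Variables (R : realType) (n : nat) (f : nat -> R).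
Hypothesis f_inj : forall i j, (0 < i <= n)%N -> (0 < j <= n)%N -> f i = f j -> i = j.

Let w := sorting_perm n f.
Let word : seq nat := [seq (w i).+1 | i <- enum 'I_n].

Let word_perm : perm_eq word (iota 1 n).
Proof.
apply: uniq_perm; first by rewrite map_inj_uniq ?enum_uniq // => i j [/val_inj/perm_inj].
  exact: iota_uniq.
move=> a; rewrite mem_iota; apply/mapP/idP => [[i _ ->]|/andP[a1 an]].
  by rewrite add1n ltnS; apply: (ltn_ord (w i)).
have h : (a.-1 < n)%N by rewrite -ltnS prednK // -add1n.
exists (w^-1 (Ordinal h))%g; first by rewrite mem_enum.
by rewrite permKV /=; case: (a) a1.
Qed.

Let word_pairwise : pairwise (fun a b => f a < f b) word.
Proof.
rewrite pairwise_map.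
have : pairwise (fun i j : 'I_n => (i < j)%N) (enum 'I_n).
  rewrite -(pairwise_map val ltn) val_enum_ord -(sorted_pairwise ltn_trans).
  exact: iota_ltn_sorted.
apply: sub_pairwise => i j; apply: sorting_permP => i' j' /f_inj e.
by apply/val_inj/eqP; rewrite -eqSS; apply/eqP/e; apply: ltn_ord.
Qed.

Let word_filter (r : rel nat) (p : pred nat) : transitive r ->
  (forall a b, p a -> p b -> (0 < a <= n)%N -> (0 < b <= n)%N ->
     f a < f b -> r a b) ->
  sorted r [seq x <- word | p x].
Proof.
move=> r_tr H; rewrite sorted_pairwise //.
apply: (sub_in_pairwise (P := fun x => p x && (0 < x <= n)%N)) _ _ (pairwise_filter p word_pairwise).
  by move=> a b /andP[pa an] /andP[pb bn]; apply: H.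
apply/allP => x; rewrite mem_filter (perm_mem word_perm) mem_iota => /andP[px xn].
by rewrite px; move: xn; rewrite add1n ltnS.
Qed.

Let word_uniq : uniq word. Proof. by rewrite (perm_uniq word_perm) iota_uniq. Qed.

Lemma sorting_perm_increasing k (c : nat -> nat) :
  (forall i j, (0 < i)%N -> (i < j <= n)%N -> c i = c j -> (c i < k)%N ->
     f i < f j) ->
  (count (fun x => c x < k) (iota 1 n) <= rowsum (sh w) k)%N.
Proof.
move=> H; rewrite -(seq.permP word_perm); apply: greene_increasing => // l lk.
apply: word_filter => [|a b /eqP ca /eqP cb an bn fab]; first exact: ltn_trans.
rewrite /= ltnNge; apply/negP; rewrite leq_eqVlt => /predU1P[e|ba].
  by rewrite e ltxx in fab.
have /andP[b0 _] := bn; have /andP[_ an'] := an.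
have := H b a b0; rewrite ba an' cb ca => /(_ isT erefl lk) fba.
by have := lt_trans fab fba; rewrite ltxx.
Qed.

Lemma sorting_perm_decreasing k (c : nat -> nat) :
  (forall i j, (0 < i)%N -> (i < j <= n)%N -> c i = c j -> (c i < k)%N ->
     f j < f i) ->
  (count (fun x => c x < k) (iota 1 n) <= colsum (sh w) k)%N.
Proof.
move=> H; rewrite -(seq.permP word_perm); apply: greene_decreasing => // l lk.
apply: word_filter => [b a d /= ab bd|a b /eqP ca /eqP cb an bn fab].
  exact: ltn_trans bd ab.
rewrite /= ltnNge; apply/negP; rewrite leq_eqVlt => /predU1P[e|ab].
  by rewrite e ltxx in fab.
have /andP[a0 _] := an; have /andP[_ bn'] := bn.
have := H a b a0; rewrite ab bn' cb ca => /(_ isT erefl lk) fba.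
by have := lt_trans fab fba; rewrite ltxx.
Qed.

Lemma shape_sorting_perm : sorted geq (sh w) /\ sumn (sh w) = n.
Proof.
have [s e] := shape_insertion word_uniq; split=> //.
by rewrite e (perm_size word_perm) size_iota.
Qed.

End SortedWord.

(** * Lattice points in a box *)
Lemma int_threshold (p : pred int) (lo hi : int) :
  lo <= hi -> ~~ p lo -> p hi -> exists2 b, p b & ~~ p (b - 1).
Proof.
move=> lohi nlo phi.
have : exists m : nat, p (lo + m%:Z) by exists `|hi - lo|%N; rewrite (_ : lo + _ = hi) //; lia.
move=> ex; case: (ex_minnP ex) => m pm mmin.
exists (lo + m%:Z) => //; apply/negP => pm'.
case: m pm mmin pm' => [|m] pm mmin pm'; first by rewrite addr0 (negbTE nlo) in pm.
have e : lo + m.+1%:Z - 1 = lo + m%:Z by lia.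
by rewrite e in pm'; have := mmin _ pm'; rewrite ltnn.
Qed.

Lemma int_gap (k m j : int) : 1 <= k -> 0 <= j -> 0 < m -> m <= j + 1 ->
  k * (j + m) + 1 < (k + 1) * m -> False.
Proof. nia. Qed.

Lemma max_step (a l t k : int) : 0 <= k ->
  Num.max a (l - (t + k)) <= Num.max a (l - t) <= Num.max a (l - (t + k)) + k.
Proof. lia. Qed.

Section Windows.
Variables (R : realType) (q q' e e' P0 P1 Q0 Q1 : R) (uP uQ : pred R).
Variables (a0 b0 : int).

(** [px] and [py] are the coordinates of [a u + b v] for [u = (q, e)] and
    [v = (q', - e')]. *)
Definition px (a b : int) : R := q * a%:~R + q' * b%:~R.
Definition py (a b : int) : R := e * a%:~R - e' * b%:~R.
Definition in_box (a b : int) : bool :=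
  [&& P0 < px a b, uP (px a b), Q0 < py a b & uQ (py a b)].

(** A side of the box may belong to it or not, and the quarter turn that
    exchanges rows and columns exchanges the two cases; [u] stands for [_ < M]
    or [_ <= M]. *)
Definition upper (M : R) (u : pred R) : Prop :=
  [/\ forall r s, r <= s -> u s -> u r, forall r, u r -> r <= M &
      forall r, r < M -> u r].

Hypotheses (q_gt0 : 0 < q) (q_le : q <= q') (e'_gt0 : 0 < e') (e_ge : e' <= e).
Hypothesis covol : q' * e + q * e' = 1.
Hypothesis skew : q * e' < q' * e.
Hypotheses (uPP : upper P1 uP) (uQP : upper Q1 uQ).
Hypotheses (P0E : px a0 b0 = P0) (Q0E : py a0 b0 = Q0).
Hypothesis steep : (Q1 - Q0) * q < (P1 - P0) * e.

Let e_gt0 : 0 < e. Proof. exact: lt_le_trans e_ge. Qed.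
Let q'_gt0 : 0 < q'. Proof. exact: lt_le_trans q_le. Qed.

(** On line [b] the box lies between [max (left b) (bot b)] and the first of
    the two points where the line leaves through the right or the top side.
    [slope] is the largest integer step of a window for which points of equal
    offset still advance to the right from a line to the next. *)
Definition left (b : int) : int := Num.floor ((P0 - q' * b%:~R) / q) + 1.
Definition bot (b : int) : int := Num.floor ((Q0 + e' * b%:~R) / e) + 1.
Definition slope : int := Num.floor (q' / q).

Lemma pxD a b c d :
  px (a + c) (b + d) = px a b + (q * c%:~R + q' * d%:~R).
Proof. by rewrite /px !intrD; ring. Qed.

Lemma pyD a b c d :
  py (a + c) (b + d) = py a b + (e * c%:~R - e' * d%:~R).
Proof. by rewrite /py !intrD; ring. Qed.

Lemma leftE a b : (left b <= a) = (P0 < px a b).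
Proof.
by rewrite /left lezD1 floor_lt_int ltr_pdivrMr // /px ltrBlDr [a%:~R * _]mulrC.
Qed.

Lemma botE a b : (bot b <= a) = (Q0 < py a b).
Proof.
by rewrite /bot lezD1 floor_lt_int ltr_pdivrMr // /py ltrBrDr [a%:~R * _]mulrC.
Qed.

Lemma slopeP : [/\ 1 <= slope, q * slope%:~R <= q' & q' < q * (slope%:~R + 1)].
Proof.
rewrite /slope; split.
- by rewrite floor_ge_int ler_pdivlMr // mul1r.
- by rewrite mulrC -ler_pdivlMr // floor_le.
- by rewrite mulrC -ltr_pdivrMr // -[1]/(1%:~R) -intrD floorD1_gt.
Qed.

Lemma a_of_pxy a b : a%:~R = e' * px a b + q' * py a b.
Proof. rewrite /px /py -[LHS]mul1r -covol; ring. Qed.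

Lemma b_of_pxy a b : b%:~R = e * px a b - q * py a b.
Proof. rewrite /px /py -[LHS]mul1r -covol; ring. Qed.

Lemma left_slope b d : 0 <= d -> left (b + d) + slope * d <= left b.
Proof.
move=> d0; have [_ k1 _] := slopeP; rewrite -lerBrDr leftE pxD.
have : P0 < px (left b) b by rewrite -leftE.
move/lt_le_trans; apply; rewrite lerDl intrN intrM.
rewrite [leRHS](_ : _ = (q' - q * slope%:~R) * d%:~R); last by ring.
by rewrite mulr_ge0 ?subr_ge0 // ler0z.
Qed.

Lemma left_step b : left (b - 1) <= left b + (slope + 1).
Proof.
have [_ _ k2] := slopeP; rewrite leftE pxD.
have : P0 < px (left b) b by rewrite -leftE.
by move/lt_trans; apply; rewrite intrD intrN mulr1z; lra.
Qed.

Lemma bot_le b d : 0 <= d -> bot b <= bot (b + d).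
Proof.
move=> d0; rewrite botE.
have : Q0 < py (bot (b + d)) (b + d) by rewrite -botE.
move: (bot _) => c; have -> : py c (b + d) = py c b - e' * d%:~R.
  by rewrite /py intrD; ring.
move/lt_le_trans; apply.
by rewrite gerDl oppr_le0 mulr_ge0 ?ler0z // ltW.
Qed.

Lemma bot_step b : bot (b + 1) <= bot b + 1.
Proof.
rewrite botE pyD; have : Q0 < py (bot b) b by rewrite -botE.
by move/lt_le_trans; apply; rewrite lerDl -mulrBl mulr_ge0 // subr_ge0.
Qed.

Lemma archimedean_mul (x y : R) : 0 < y -> exists N : nat, x < y * N%:R.
Proof.
move=> y0; exists (Num.bound (`|x| / y)).
rewrite -ltr_pdivrMl // mulrC; apply: le_lt_trans (archi_boundP _).
  by rewrite ler_pM2r ?invr_gt0 // ler_norm.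
by rewrite divr_ge0 // ltW.
Qed.

Section OneWidth.
Variable X : nat.
Hypothesis X_le : X%:R * (q' * e - q * e') <= (Q1 - Q0) * q' - (P1 - P0) * e'.

Let uP_lt c d : c <= d -> uP d -> uP c. Proof. by case: uPP => + _ _; apply. Qed.
Let uP_le c : uP c -> c <= P1. Proof. by case: uPP => _ + _; apply. Qed.
Let uPN c : ~~ uP c -> P1 <= c.
Proof. by case: uPP => _ _ h; apply: contraNT; rewrite -ltNge => /h. Qed.
Let uQ_lt c d : c <= d -> uQ d -> uQ c. Proof. by case: uQP => + _ _; apply. Qed.
Let uQ_le c : uQ c -> c <= Q1. Proof. by case: uQP => _ + _; apply. Qed.
Let uQN c : ~~ uQ c -> Q1 <= c.
Proof. by case: uQP => _ _ h; apply: contraNT; rewrite -ltNge => /h. Qed.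

(** Lines of small index leave the box through the top, lines of large index
    enter it from the bottom.  [enters A b] says that [X] points of line [b]
    counted from [max (left b) A] stay below the top; [leaves b] that [X] points
    counted from the bottom side do not stay within the right side. *)
Definition enters (A b : int) : bool :=
  uQ (py (Num.max (left b) A + (X%:Z - 1)) b).
Definition leaves (b : int) : bool := ~~ uP (px (bot b + (X%:Z - 1)) b).

Lemma exists_last : exists2 b, ~~ leaves b & leaves (b + 1).
Proof.
have [N hN] := archimedean_mul (P1 - q * (bot 0 + (X%:Z - 1))%:~R) q'_gt0.
have [M hM] := archimedean_mul (q * (bot 0 + (X%:Z - 1))%:~R - P1) q'_gt0.
have [|||b lb nb] := int_threshold (p := leaves) (lo := - M%:Z) (hi := N%:Z).
- by rewrite (@le_trans _ _ 0) // oppr_le0.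
- rewrite negbK.
  have uPM : uP (px (bot 0 + (X%:Z - 1)) (- M%:Z)).
    case: uPP => _ _; apply; rewrite /px intrN.
    by have : (M%:Z)%:~R = M%:R :> R by []; lra.
  apply: uP_lt uPM; rewrite /px lerD2r ler_wpM2l ?(ltW q_gt0) // ler_int lerD2r.
  by have := @bot_le (- M%:Z) M%:Z isT; rewrite addNr.
- apply/negP => /uP_le; apply/negP; rewrite -ltNge.
  apply: lt_le_trans (_ : px (bot 0 + (X%:Z - 1)) N%:Z <= _).
    by rewrite /px; have : (N%:Z)%:~R = N%:R :> R by []; lra.
  rewrite /px lerD2r ler_wpM2l ?(ltW q_gt0) // ler_int lerD2r.
  by have := @bot_le 0 N%:Z isT; rewrite add0r.
- by exists (b - 1); rewrite // subrK.
Qed.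

Lemma exists_first A : exists2 b, enters A b & ~~ enters A (b - 1).
Proof.
pose C := Num.max (left 0) A + (X%:Z - 1); pose D := A + (X%:Z - 1).
have [N hN] := archimedean_mul (e * C%:~R - Q1) e'_gt0.
have [M hM] := archimedean_mul (Q1 - e * D%:~R) e'_gt0.
apply: (int_threshold (p := enters A) (lo := - M%:Z) (hi := N%:Z)).
- by rewrite (@le_trans _ _ 0) // oppr_le0.
- apply/negP => /uQ_le; apply/negP; rewrite -ltNge.
  apply: lt_le_trans (_ : py D (- M%:Z) <= _).
    by rewrite /py intrN; have : (M%:Z)%:~R = M%:R :> R by []; lra.
  rewrite /py lerD2r ler_wpM2l ?(ltW e_gt0) // ler_int lerD2r.
  by rewrite le_max lexx orbT.
- have uQM : uQ (py C N%:Z).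
    case: uQP => _ _; apply; rewrite /py.
    by have : (N%:Z)%:~R = N%:R :> R by []; lra.
  apply: uQ_lt uQM; rewrite /py lerD2r ler_wpM2l ?(ltW e_gt0) // ler_int lerD2r.
  rewrite ge_max !le_max lexx !orbT andbT; apply/orP; left.
  have [k1 _ _] := slopeP.
  have := @left_slope 0 N%:Z isT; rewrite add0r; apply: le_trans.
  by rewrite lerDl mulr_ge0 // (le_trans _ k1).
Qed.

Section Corners.
Variables b1 b2 : int.
Let A := bot b2.
Hypotheses (ent1 : enters A b1) (ent0 : ~~ enters A (b1 - 1)).
Hypotheses (lea0 : ~~ leaves b2) (lea1 : leaves (b2 + 1)).

Let left_gt b : P0 < px (left b) b. Proof. by rewrite -leftE. Qed.
Let left_le b : px (left b) b <= P0 + q.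
Proof.
have : ~~ (P0 < px (left b - 1) (b + 0)) by rewrite -leftE addr0 -ltNge ltrBlDr ltzD1.
by rewrite pxD -leNgt intrN mulr1z; lra.
Qed.
Let bot_le' b : py (bot b) b <= Q0 + e.
Proof.
have : ~~ (Q0 < py (bot b - 1) (b + 0)) by rewrite -botE addr0 -ltNge ltrBlDr ltzD1.
by rewrite pyD -leNgt intrN mulr1z; lra.
Qed.

Let pxX c b : px (c + (X%:Z - 1)) b = px c b + q * (X%:R - 1).
Proof. by rewrite -[b in LHS]addr0 pxD intrD intrN mulr1z; ring. Qed.
Let pyX c b : py (c + (X%:Z - 1)) b = py c b + e * (X%:R - 1).
Proof. by rewrite -[b in LHS]addr0 pyD intrD intrN mulr1z; ring. Qed.

Let aA : A%:~R - 1 <= e' * (P1 - q * X%:R) + q' * Q0.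
Proof.
have := a_of_pxy A b2; have := bot_le' b2; rewrite -/A.
move: lea0; rewrite negbK => /uP_le; rewrite pxX -/A.
move: (px A b2) (py A b2) (A%:~R) => p s a h1 h2 ->.
have e1 : e' * p <= e' * (P1 - q * (X%:R - 1)) by rewrite ler_pM2l //; lra.
have e2 : q' * s <= q' * (Q0 + e) by rewrite ler_pM2l.
have := covol; nra.
Qed.

(** Otherwise the point [A - 1] of line [b1 - 1] is to the right of the left
    side and [X] points of that line counted from [A] cross the top, whereas the
    point [A] of line [b2] is at most one step above the bottom side and [X]
    points counted from it stay within the right side.  The two bounds on [A]
    contradict the one on [X]. *)
Lemma left_before : A <= left (b1 - 1).
Proof.
rewrite leNgt; apply/negP => lA.
have lA' : left (b1 - 1) <= A - 1 by rewrite lerBrDr lezD1.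
move: ent0; rewrite /enters (max_idPr (ltW lA)) => /uQN; rewrite pyX => h2.
have h1 : P0 < px (A - 1) (b1 - 1) by rewrite -leftE.
have := a_of_pxy (A - 1) (b1 - 1).
have -> : py (A - 1) (b1 - 1) = py A (b1 - 1) - e.
  by rewrite -[b1 - 1]addr0 pyD addr0 intrN mulr1z; ring.
rewrite intrD intrN mulr1z.
move: h1 h2 aA; move: (px _ _) (py _ _) (A%:~R) => p s a h1 h2 h3 h4.
have e1 : e' * P0 < e' * p by rewrite ltr_pM2l.
have e2 : q' * (Q1 - e * X%:R) <= q' * (s - e) by rewrite ler_pM2l //; lra.
by have := X_le; nra.
Qed.

Let b1_gt : e * P0 - q * (Q1 - e * (X%:R - 1)) < b1%:~R.
Proof.
have h2 : py (left b1 + (X%:Z - 1)) b1 <= Q1.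
  apply: uQ_le; apply: uQ_lt ent1; rewrite /py lerD2r ler_wpM2l ?(ltW e_gt0) //.
  by rewrite ler_int lerD2r le_max lexx.
move: h2; rewrite pyX (b_of_pxy (left b1) b1).
have := left_gt b1; move: (px _ _) (py _ _) => p s h1 h2.
have e1 : e * P0 < e * p by rewrite ltr_pM2l.
have e2 : q * s <= q * (Q1 - e * (X%:R - 1)) by rewrite ler_pM2l //; lra.
by lra.
Qed.

Let b1_le : b1%:~R - 1 <= e * P0 - q * Q1 + q * e * X%:R.
Proof.
have h2 : Q1 <= py (left (b1 - 1) + (X%:Z - 1)) (b1 - 1).
  by move: ent0; rewrite /enters (max_idPl left_before) => /uQN.
have := b_of_pxy (left (b1 - 1)) (b1 - 1); rewrite intrD intrN mulr1z => ->.
move: h2; rewrite pyX.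
have := left_le (b1 - 1); move: (px _ _) (py _ _) => p s h1 h2.
have e1 : e * p <= e * (P0 + q) by rewrite ler_pM2l.
have e2 : q * (Q1 - e * (X%:R - 1)) <= q * s by rewrite ler_pM2l //; lra.
by nra.
Qed.

Let b2_ge : e * P1 - q * Q0 - q * e * X%:R <= b2%:~R + 1.
Proof.
move: lea1 => /uPN; rewrite pxX => h2.
have := b_of_pxy (bot (b2 + 1)) (b2 + 1); rewrite intrD mulr1z => ->.
have := bot_le' (b2 + 1); move: h2; move: (px _ _) (py _ _) => p s h1 h2.
have e1 : q * s <= q * (Q0 + e) by rewrite ler_pM2l.
have e2 : e * (P1 - q * (X%:R - 1)) <= e * p by rewrite ler_pM2l //; lra.
by nra.
Qed.

(** Both ends are within one unit of their ideal real positions, hence a loss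
    of at most two units, of which the [+ 1] in the number of lines makes up
    for one. *)
Lemma width_lb :
  (Q1 - Q0) * q + (P1 - P0) * e - 2 * X%:R * q * e - 1 <= (b2 - b1 + 1)%:~R.
Proof. by rewrite !intrD intrN mulr1z; have := b1_le; have := b2_ge; lra. Qed.

Let b0E : b0%:~R = e * P0 - q * Q0. Proof. by rewrite (b_of_pxy a0 b0) P0E Q0E. Qed.

Let XqP : X%:R * q < P1 - P0.
Proof.
have D0 : 0 < q' * e - q * e' by rewrite subr_gt0.
have h1 := X_le; rewrite -(ler_pM2l q_gt0) in h1.
have h2 := steep; rewrite -(ltr_pM2l q'_gt0) in h2.
rewrite -(ltr_pM2r D0); lra.
Qed.

Let XeQ : X%:R * e < Q1 - Q0.
Proof.
have D0 : 0 < q' * e - q * e' by rewrite subr_gt0.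
have h1 := X_le; rewrite -(ler_pM2l e_gt0) in h1.
have h2 := steep; rewrite -(ltr_pM2l e'_gt0) in h2.
rewrite -(ltr_pM2r D0); lra.
Qed.

(** The line through the lower left corner of the box has room for [X] points,
    by [XqP] on the right and by [XeQ] at the top, so it lies between the two
    ends. *)
Lemma b0_b2 : b0 <= b2.
Proof.
rewrite -ltzD1 -(ltr_int R) intrD mulr1z b0E; have := b2_ge.
by have : e * (X%:R * q) < e * (P1 - P0); [rewrite ltr_pM2l|lra].
Qed.

Lemma b1_b0 : b1 <= b0.
Proof.
rewrite -ltzD1 -(ltr_int R) intrD mulr1z b0E; have := b1_le.
by have : q * (X%:R * e) < q * (Q1 - Q0); [rewrite ltr_pM2l|lra].
Qed.

Lemma b1_b2_sym : b0 - b1 <= b2 - b0 + 1.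
Proof.
rewrite -ltzD1 -(ltr_int R) !intrD !intrN !mulr1z.
have := b1_gt; have := b2_ge; have := steep; have := covol; have := b0E.
have : q * e <= q' * e by rewrite ler_pM2r.
have : 0 < q * e' by rewrite mulr_gt0.
by lra.
Qed.

(** Steps of size [slope] lead from [left b1] down to [A] within [b2 - b1]
    lines.  The starting points run along the left side as far as the corner
    [(a0, b0)] at a mean rate [q' / q < slope + 1].  If the steps did not reach
    [A], the fewer than [(slope + 1) (b0 - b1)] points gained along the left
    side would exceed [slope (b2 - b1)], which [b1_b2_sym] excludes.  That the corner is a lattice point is
    what makes the count exact. *)
Lemma left_reaches : left b1 - slope * (b2 - b1) <= A.
Proof.
rewrite leNgt; apply/negP => lA.
have [k1 _ k2] := slopeP.
have l1 : px (left b1) b1 <= px (a0 + 1) b0.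
  by apply: le_trans (left_le b1) _; rewrite -[b0]addr0 pxD P0E mulr1z; lra.
have Aa0 : a0 + 1 <= A.
  have : bot b0 <= A by have := @bot_le b0 (b2 - b0); rewrite subr_ge0 b0_b2 subrKC; apply.
  by apply: le_trans; rewrite lezD1 ltNge botE Q0E ltxx.
pose m := b0 - b1; pose j := b2 - b0.
have m0 : 0 <= m by rewrite subr_ge0 b1_b0.
have j0 : 0 <= j by rewrite subr_ge0 b0_b2.
have mj : m <= j + 1 := b1_b2_sym.
have h : slope * (j + m) + 1 <= left b1 - (a0 + 1).
  have -> : j + m = b2 - b1 by rewrite /j /m; ring.
  rewrite lezD1 ltrBrDr; apply: le_lt_trans (_ : _ <= slope * (b2 - b1) + A) _.
    by rewrite lerD2l.
  by rewrite addrC -ltrBrDr.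
have h' : q * (left b1 - (a0 + 1))%:~R <= q' * m%:~R.
  by move: l1; rewrite /px /m !(intrD, intrN); lra.
have h'' : q * (slope * (j + m) + 1)%:~R <= q' * m%:~R.
  by apply: le_trans h'; rewrite ler_pM2l // ler_int.
have m_pos : 0 < m.
  rewrite -(ltr_int R) -(pmulr_rgt0 _ q'_gt0); apply: lt_le_trans h''.
  rewrite mulr_gt0 // ltr0z ltzD1.
  by apply: mulr_ge0; [exact: le_trans k1|exact: addr_ge0].
apply: (int_gap k1 j0 m_pos mj); rewrite -(ltr_int R) -(ltr_pM2l q_gt0).
apply: le_lt_trans h'' _.
by rewrite intrM mulrA intrD mulr1z ltr_pM2r // ltr0z.
Qed.

(** The starting points of the windows.  When [left b1 >= A], they descend at the
    maximal rate from [left b1] until they are stopped at [A], and extend to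
    the smaller lines at the same rate.  Otherwise they are constant from [b1]
    on, and before [b1] they stay as close to [left] as the step to [A]
    permits. *)
Definition path (b : int) : int :=
  if A <= left b1 then Num.max A (left b1 - slope * (b - b1))
  else if b1 <= b then A
  else Num.min (left (b1 - 1)) (A + slope) + slope * (b1 - 1 - b).

Let k_ge0 : 0 <= slope. Proof. by have [k1 _ _] := slopeP; apply: le_trans k1. Qed.

Let left_le_slope b d : b <= d -> left d + slope * (d - b) <= left b.
Proof. by move=> bd; have := @left_slope b (d - b); rewrite subr_ge0 subrKC; apply. Qed.

Let bot_mono b d : b <= d -> bot b <= bot d.
Proof. by move=> bd; have := @bot_le b (d - b); rewrite subr_ge0 subrKC; apply. Qed.

Lemma path_step b : path (b + 1) <= path b <= path (b + 1) + slope.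
Proof.
rewrite /path; case: ifP => _.
  have -> : slope * (b + 1 - b1) = slope * (b - b1) + slope by ring.
  exact: max_step.
have [b1b|bb1] := leP b1 b.
  by rewrite (le_trans b1b (_ : b <= b + 1)) lerDl // lexx k_ge0.
have [b1b|bb1'] := leP b1 (b + 1).
  have -> : b = b1 - 1 by apply/eqP; rewrite eq_le lerBrDr lezD1 bb1 lerBlDr.
  rewrite subrr mulr0 addr0 le_min left_before lerDl k_ge0 /=.
  by rewrite ge_min lexx orbT.
have -> : slope * (b1 - 1 - b) = slope * (b1 - 1 - (b + 1)) + slope by ring.
by rewrite addrA lerDl k_ge0 lexx.
Qed.

Let path_le_left b : b < b1 -> path b <= left b.
Proof.
move=> bb1; rewrite /path; case: ifP => hA.
  rewrite ge_max; apply/andP; split.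
    apply: le_trans hA _; apply: le_trans (left_le_slope (ltW bb1)).
    by rewrite lerDl mulr_ge0 // subr_ge0 ltW.
  apply: le_trans (left_le_slope (ltW bb1)).
  by rewrite (_ : _ - _ = left b1 + slope * (b1 - b)) //; ring.
rewrite (leNgt b1) bb1 /=; have h : b <= b1 - 1 by rewrite lerBrDr lezD1.
apply: le_trans (left_le_slope h); rewrite lerD2r.
by rewrite ge_min lexx.
Qed.

Let path_ge_left b : b < b1 -> left (b1 - 1) <= path b + 1.
Proof.
move=> bb1; have h : b <= b1 - 1 by rewrite lerBrDr lezD1.
have st := left_step b1; rewrite /path; case: ifP => hA.
  apply: le_trans st _; rewrite addrA lerD2r le_max; apply/orP; right.
  rewrite lerD2l -mulrN opprB ler_peMr // -gtz0_ge1 subr_gt0 //.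
rewrite (leNgt b1) bb1 /=.
have h2 : 0 <= slope * (b1 - 1 - b) by rewrite mulr_ge0 // subr_ge0.
have h3 : left (b1 - 1) <= A + slope.
  apply: le_trans st _; rewrite (_ : _ + _ = (left b1 + 1) + slope); last by ring.
  by rewrite lerD2r lezD1 ltNge hA.
rewrite (min_idPl h3) -addrA lerDl addr_ge0 //.
Qed.

Let path_ge_A b : b1 <= b -> A <= path b.
Proof. by move=> b1b; rewrite /path b1b; case: ifP => // _; rewrite le_max lexx. Qed.

(** The window starts at or before [left b], hence before the box, and not
    before [left (b1 - 1) - 1]; line [b1 - 1] crosses the top within [X] points
    from [left (b1 - 1)], and the smaller lines rise above it. *)
Lemma window_before b c : b < b1 -> in_box c b -> path b <= c < path b + X%:Z.
Proof.
move=> bb1 /and4P[]; rewrite -leftE => lc _ _ uc.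
rewrite (le_trans (path_le_left bb1) lc) /= ltNge; apply/negP => pc.
move: ent0; rewrite /enters (max_idPl left_before) => /negP; apply.
apply: uQ_lt uc; rewrite /py lerB //.
  rewrite ler_pM2l // ler_int addrCA; apply: le_trans pc.
  by rewrite addrC lerD2r lerBlDr path_ge_left.
by rewrite ler_pM2l // ler_int lerBrDr lezD1.
Qed.

Lemma window_after b c : b2 < b -> in_box c b -> path b <= c < path b + X%:Z.
Proof.
move=> b2b /and4P[_ uc]; rewrite -botE => bc _.
have b1b : b1 <= b by apply: le_trans b1_b0 _; apply: le_trans b0_b2 (ltW b2b).
have -> : path b = A.
  rewrite /path b1b; case: ifP => // _; apply/max_idPl.
  apply: le_trans left_reaches; rewrite lerD2l lerN2 ler_wpM2l //.
  by rewrite lerD2r ltW.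
rewrite (le_trans (bot_mono (ltW b2b)) bc) /= ltNge; apply/negP => pc.
move: lea1 => /negP; apply; apply: uP_lt uc; rewrite /px lerD //.
  rewrite ler_pM2l // ler_int addrCA; apply: le_trans pc.
  by rewrite addrC lerD2r lerBlDr bot_step.
by rewrite ler_pM2l // ler_int lezD1.
Qed.

Lemma window_inside b c :
  b1 <= b <= b2 -> path b <= c < path b + X%:Z -> in_box c b.
Proof.
move=> /andP[b1b bb2] /andP[pc cp].
have cX : c <= path b + (X%:Z - 1) by rewrite addrA lerBrDr lezD1.
have pM : path b <= Num.max (left b1) A.
  rewrite /path b1b; case: ifP => hA; last by rewrite le_max lexx orbT.
  rewrite ge_max !le_max lexx orbT /= gerDl oppr_le0 mulr_ge0 // subr_ge0 //.
have pk : path b <= A + slope * (b2 - b).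
  have h : 0 <= slope * (b2 - b) by rewrite mulr_ge0 // subr_ge0.
  rewrite /path b1b; case: ifP => hA; last by rewrite lerDl.
  rewrite ge_max lerDl h /= -lerBlDr; apply: le_trans left_reaches.
  by rewrite (_ : _ - _ = left b1 - slope * (b2 - b1)) //; ring.
apply/and4P; split.
- rewrite -leftE; apply: le_trans pc.
  have h := left_le_slope b1b; rewrite /path b1b; case: ifP => hA.
    by rewrite le_max lerBrDr h orbT.
  have lA : left b1 < A by rewrite ltNge hA.
  apply: le_trans (ltW lA); apply: le_trans h.
  by rewrite lerDl mulr_ge0 // subr_ge0.
- move: lea0; rewrite negbK; apply: uP_lt.
  rewrite /px -/A; have [_ k1 _] := slopeP.
  have h1 : q * c%:~R <= q * (A + slope * (b2 - b) + (X%:Z - 1))%:~R.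
    by rewrite ler_pM2l // ler_int (le_trans cX) // lerD2r.
  have h2 : q * slope%:~R * (b2 - b)%:~R <= q' * (b2 - b)%:~R.
    by rewrite ler_wpM2r // ler0z subr_ge0.
  move: h1 h2; rewrite !(intrD, intrM, intrN); lra.
- rewrite -botE; apply: le_trans pc; apply: le_trans (path_ge_A b1b).
  exact: bot_mono.
- apply: uQ_lt ent1; rewrite /py lerB //.
    by rewrite ler_pM2l // ler_int (le_trans cX) // lerD2r.
  by rewrite ler_pM2l // ler_int.
Qed.

End Corners.

End OneWidth.

Lemma windows (X : nat) :
  X%:R * (q' * e - q * e') <= (Q1 - Q0) * q' - (P1 - P0) * e' ->
  exists (s : int -> int) (b1 b2 : int),
  [/\ forall b, s (b + 1) <= s b <= s (b + 1) + slope, b1 <= b2,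
      (Q1 - Q0) * q + (P1 - P0) * e - 2 * X%:R * q * e - 1 <= (b2 - b1 + 1)%:~R,
      forall b c, (b < b1) || (b2 < b) -> in_box c b -> s b <= c < s b + X%:Z &
      forall b c, b1 <= b <= b2 -> s b <= c < s b + X%:Z -> in_box c b].
Proof.
move=> hX; have [b2 lea0 lea1] := exists_last X.
have [b1 ent1 ent0] := exists_first X (bot b2).
exists (path b1 b2), b1, b2; split.
- by move=> b; apply: (path_step hX ent0 lea0).
- exact: le_trans (b1_b0 hX ent0 lea0) (b0_b2 hX lea1).
- apply: (width_lb hX ent0 lea0 lea1).
- move=> b c /orP[]; first exact: (window_before hX ent0 lea0).
  exact: (window_after hX ent1 ent0 lea0 lea1).
- exact: (window_inside hX ent1 ent0 lea0 lea1).
Qed.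

(** From a line to the next the position changes by [q'] minus at most [slope]
    times [q], which is nonnegative, and the height drops by at least [e']. *)
Lemma offset_class_decreasing (s : int -> int) (b d j : int) :
  (forall b, s (b + 1) <= s b <= s (b + 1) + slope) -> b < d ->
  px (s b + j) b <= px (s d + j) d /\ py (s d + j) d < py (s b + j) b.
Proof.
move=> sP bd; have [_ k1 _] := slopeP.
have : s d <= s b <= s d + slope * (d - b).
  have [m ->] : exists m : nat, d = b + m%:Z.
    by exists `|d - b|%N; rewrite gez0_abs ?subr_ge0 ?ltW // subrKC.
  elim: m => [|m IH]; first by rewrite addr0 subrr mulr0 addr0 lexx.
  have := sP (b + m%:Z); rewrite intS (addrC 1) addrA.
  have -> : b + m%:Z + 1 - b = (b + m%:Z - b) + 1 by ring.
  rewrite mulrDr mulr1 => /andP[h1 h2]; have /andP[h3 h4] := IH.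
  rewrite (le_trans h1 h3) /=; apply: le_trans h4 _.
  by rewrite [leRHS]addrCA [leLHS]addrC lerD2l.
move=> /andP[h1 h2].
have dbR : 0 < (d - b)%:~R :> R by rewrite ltr0z subr_gt0.
split.
  have e1 : q * (s b)%:~R <= q * (s d + slope * (d - b))%:~R.
    by rewrite ler_pM2l // ler_int.
  have e2 : q * slope%:~R * (d - b)%:~R <= q' * (d - b)%:~R by rewrite ler_pM2r.
  by move: e1 e2; rewrite /px !(intrD, intrM, intrN); lra.
have e1 : e * (s d)%:~R <= e * (s b)%:~R by rewrite ler_pM2l // ler_int.
have e2 : 0 < e' * (d - b)%:~R by rewrite mulr_gt0.
by move: e1 e2; rewrite /py !(intrD, intrM, intrN); lra.
Qed.

Lemma line_px (b c d : int) : c < d -> px c b < px d b /\ py c b < py d b.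
Proof.
by move=> cd; rewrite /px /py ltrD2r ltrBDr subrK !ltr_pM2l // !ltr_int.
Qed.

(** A line that passes too close to the upper left or the lower right corner of
    the box has at most [X] points in it. *)
Lemma short_line (X : nat) (b : int) :
  (b%:~R <= e * P0 - q * (Q1 - e * X%:R)) || (e * (P1 - q * X%:R) - q * Q0 <= b%:~R) ->
  exists s : int, forall c, in_box c b -> s <= c < s + X%:Z.
Proof.
have pX c : px (c + X%:Z) b = px c b + q * X%:R.
  by rewrite /px intrD; have : (X%:Z)%:~R = X%:R :> R by []; lra.
have pY c : py (c + X%:Z) b = py c b + e * X%:R.
  by rewrite /py intrD; have : (X%:Z)%:~R = X%:R :> R by []; lra.
case/orP => hb; [exists (left b)|exists (bot b)] => c /and4P[]; rewrite -leftE -botE.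
  move=> lc _ _ uc; rewrite lc /= ltNge; apply/negP => cX.
  have h1 : P0 < px (left b) b by rewrite -leftE.
  have h2 : py (left b + X%:Z) b <= Q1.
    case: uQP => mono lt _; apply: lt; apply: mono uc.
    by rewrite /py lerD2r ler_pM2l // ler_int.
  move: hb; rewrite (b_of_pxy (left b) b) leNgt => /negP; apply; rewrite pY in h2.
  have e1 : e * P0 < e * px (left b) b by rewrite ltr_pM2l.
  have e2 : q * py (left b) b <= q * (Q1 - e * X%:R) by rewrite ler_pM2l // lerBrDr.
  by lra.
move=> _ uc bc _; rewrite bc /= ltNge; apply/negP => cX.
have h1 : Q0 < py (bot b) b by rewrite -botE.
have h2 : px (bot b + X%:Z) b <= P1.
  case: uPP => mono lt _; apply: lt; apply: mono uc.
  by rewrite /px lerD2r ler_pM2l // ler_int.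
move: hb; rewrite (b_of_pxy (bot b) b) leNgt => /negP; apply; rewrite pX in h2.
have e1 : q * Q0 < q * py (bot b) b by rewrite ltr_pM2l.
have e2 : e * px (bot b) b <= e * (P1 - q * X%:R) by rewrite ler_pM2l // lerBrDr.
by lra.
Qed.

End Windows.

(** * Counting integer points *)
Lemma sum_count_fiber (T : Type) (U : eqType) (f : T -> U) (p : pred T)
    (s : seq T) (L : seq U) :
  uniq L -> all (fun i => f i \in L) s ->
  (\sum_(b <- L) count (fun i => p i && (f i == b)) s = count p s)%N.
Proof.
move=> uL; elim: s => [|i s IH] /=; first by rewrite big1.
move=> /andP[fi sL]; rewrite big_split /= IH //; congr addn.
rewrite (bigD1_seq (f i)) //= eqxx andbT big1 ?addn0 // => b bi.
by rewrite eq_sym (negbTE bi) andbF.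
Qed.

Lemma count_window_le (p : pred nat) (a : nat -> int) (s : int) (X : nat) (r : seq nat) :
  uniq r -> {in [seq i <- r | p i] &, injective a} ->
  (forall i, i \in r -> p i -> s <= a i < s + X%:Z) -> (count p r <= X)%N.
Proof.
move=> ur inja ran; rewrite -size_filter -(size_map (fun i => `|a i - s|%N)).
rewrite -[X in (_ <= X)%N](size_iota 0); apply: uniq_leq_size.
  rewrite map_inj_in_uniq ?filter_uniq // => i j ir jr e.
  apply: inja => //; move: ir jr; rewrite !mem_filter => /andP[pi ri] /andP[pj rj].
  by have := ran _ ri pi; have := ran _ rj pj; clear -e; lia.
move=> x /mapP[i]; rewrite mem_filter => /andP[pi ri] ->.
by rewrite mem_iota; have := ran _ ri pi; clear; lia.
Qed.

Lemma count_window_ge (p : pred nat) (a : nat -> int) (s : int) (X : nat) (r : seq nat) :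
  (forall c, s <= c < s + X%:Z -> exists i, [/\ i \in r, p i & a i = c]) ->
  (X <= count p r)%N.
Proof.
move=> H; rewrite -size_filter -[X in (X <= _)%N](size_iota 0).
rewrite -(size_map (fun i => `|a i - s|%N) [seq i <- r | p i]).
apply: uniq_leq_size; first exact: iota_uniq.
move=> x; rewrite mem_iota => /andP[_ xX].
have [|i [ri pi ai]] := H (s + x%:Z); first by clear -xX; lia.
by apply/mapP; exists i; rewrite ?mem_filter ?pi // ai; clear; lia.
Qed.

Lemma size_ints_in (R : realType) (u v : R) (L : seq int) : uniq L -> L != [::] ->
  (forall b, b \in L -> u < b%:~R < v) -> (size L)%:R <= v - u + 1.
Proof.
move=> uL L0 H; pose lo := Num.floor u + 1; pose hi := Num.ceil v - 1.
have ran b : b \in L -> lo <= b <= hi.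
  move=> /H /andP[ub bv]; rewrite /lo lezD1 floor_lt_int ub /=.
  by rewrite /hi lerBrDr lezD1 ceil_gt_int.
have lohi : lo <= hi.
  by case: L L0 ran {uL H} => [//|b L] _ /(_ b); rewrite inE eqxx => /(_ isT)/andP[]; apply: le_trans.
have sz : (size L <= absz (hi - lo + 1)%R)%N.
  rewrite -(size_map (fun b => `|b - lo|%N)) -[X in (_ <= X)%N](size_iota 0).
  apply: uniq_leq_size.
    rewrite map_inj_in_uniq // => b c /ran hb /ran hc.
    by move: hb hc; clear; lia.
  move=> x /mapP[b /ran hb ->]; rewrite mem_iota; move: hb; clear; lia.
have : (size L)%:R <= (hi - lo + 1)%:~R :> R.
  by rewrite -[X in X <= _]/((size L)%:Z%:~R) ler_int; move: sz lohi; clear; lia.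
have h1 : hi%:~R < v by rewrite -ceil_gt_int /hi ltrBlDr ltzD1.
have h2 : u < lo%:~R by rewrite -floor_lt_int /lo ltzD1.
by clearbody lo hi; rewrite !intrD intrN mulr1z; lra.
Qed.

(** * Column heights *)
Section Columns.
Variables (R : realType) (q q' e e' P0 P1 Q0 Q1 : R) (uP uQ : pred R).
Variables (a0 b0 : int).
Hypotheses (q_gt0 : 0 < q) (q_le : q <= q') (e'_gt0 : 0 < e') (e_ge : e' <= e).
Hypothesis covol : q' * e + q * e' = 1.
Hypothesis skew : q * e' < q' * e.
Hypotheses (uPP : upper P1 uP) (uQP : upper Q1 uQ).
Hypotheses (P0E : px q q' a0 b0 = P0) (Q0E : py e e' a0 b0 = Q0).
Hypothesis steep : (Q1 - Q0) * q < (P1 - P0) * e.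

(* [F] and [G] stand for the column sums and row sums of a partition with cells
   [cell]; the abstraction lets rows play the role of columns. *)
Variables (n : nat) (az bz : nat -> int).
Let xi i := px q q' (az i) (bz i).
Let yi i := py e e' (az i) (bz i).
Let box := in_box q q' e e' P0 Q0 uP uQ.
Hypothesis box_in : forall i, (0 < i <= n)%N -> box (az i) (bz i).
Hypothesis box_onto : forall a b, box a b ->
  exists i, [/\ (0 < i <= n)%N, az i = a & bz i = b].
Hypothesis coord_inj : forall i j, (0 < i <= n)%N -> (0 < j <= n)%N ->
  az i = az j -> bz i = bz j -> i = j.

Variables (F G : nat -> nat) (cell : nat -> nat -> bool).
Hypothesis FG : forall x k, (F x + G k <= n + k * x)%N.
Hypothesis cell_in : forall x y, cell x y -> (F x + y.+1 <= F x.+1)%N.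
Hypothesis cell_out : forall x y, ~~ cell x y -> (F x.+1 <= F x + y)%N.
Hypothesis famF : forall k (c : nat -> nat),
  (forall i j, (0 < i <= n)%N -> (0 < j <= n)%N -> i != j -> c i = c j ->
     (c i < k)%N -> (xi i <= xi j /\ yi j < yi i) \/ (xi j <= xi i /\ yi i < yi j)) ->
  (count (fun i => c i < k) (iota 1 n) <= F k)%N.
Hypothesis famG : forall k (c : nat -> nat),
  (forall i j, (0 < i <= n)%N -> (0 < j <= n)%N -> i != j -> c i = c j ->
     (c i < k)%N -> (xi i < xi j /\ yi i < yi j) \/ (xi j < xi i /\ yi j < yi i)) ->
  (count (fun i => c i < k) (iota 1 n) <= G k)%N.

Let ran i : (i \in iota 1 n) = (0 < i <= n)%N.
Proof. by rewrite mem_iota add1n ltnS. Qed.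

Let lines : seq int := undup [seq bz i | i <- iota 1 n].
Let len (b : int) : nat := count (fun i => bz i == b) (iota 1 n).
Let M (X : nat) : nat := (\sum_(b <- lines) minn (len b) X)%N.

Let lines_all : all (fun i => bz i \in lines) (iota 1 n).
Proof. by apply/allP => i ir; rewrite mem_undup map_f. Qed.

Let lines_uniq : uniq lines. Proof. exact: undup_uniq. Qed.

Let MS X : M X.+1 = (M X + count (fun b => X < len b) lines)%N.
Proof.
rewrite -sum1_count big_mkcond -big_split; apply: eq_bigr => b _ /=.
by case: (ltnP X (len b)) => h; lia.
Qed.

(** The lines with at least [X] points form a union of chains counted by [G], and
    the duality of [F] and [G] leaves at most [M X] for [F X]. *)
Let F_le X : (F X <= M X)%N.
Proof.
pose L := [seq b <- lines | X <= len b]%N.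
pose c i := index (bz i) L.
have cE i : (c i < size L)%N = (bz i \in L) by rewrite index_mem.
have uL : uniq L by rewrite filter_uniq.
have GL : (\sum_(b <- L) len b <= G (size L))%N.
  apply: leq_trans (famG (k := size L) (c := c) _); last first.
    move=> i j ir jr ij eij; rewrite cE => iL.
    have bij : bz i = bz j.
      rewrite -(nth_index 0 iL) -/(c i) eij nth_index //.
      by rewrite -cE -eij cE.
    have [aij|aji|aij] := ltgtP (az i) (az j); last first.
    - by move: ij; rewrite (coord_inj ir jr aij bij) eqxx.
    - by right; rewrite /xi /yi -bij; apply: (line_px q' q_gt0 e'_gt0 e_ge _ aji).
    - by left; rewrite /xi /yi -bij; apply: (line_px q' q_gt0 e'_gt0 e_ge _ aij).
  rewrite (eq_count cE) -(sum_count_fiber _ lines_uniq lines_all).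
  rewrite big_filter big_mkcond !big_seq; apply: leq_sum => b bl; case: ifP => // bL.
  apply: sub_count => i /eqP ib /=.
  by rewrite ib eqxx andbT mem_filter bL.
have := FG X (size L).
have -> : (size L * X = \sum_(b <- L) X)%N.
  by rewrite -sum1_size big_distrl; apply: eq_bigr => b _; exact: mul1n.
have -> : (n = \sum_(b <- lines) len b)%N.
  rewrite (sum_count_fiber xpredT lines_uniq lines_all).
  by rewrite count_predT size_iota.
have -> : (M X = \sum_(b <- L) X + \sum_(b <- lines | ~~ (X <= len b)) len b)%N.
  rewrite /M (bigID (fun b => X <= len b)%N) /= big_filter; congr addn.
    by apply: eq_bigr => b /minn_idPr.
  by apply: eq_bigr => b; rewrite -ltnNge => /ltnW/minn_idPl.
rewrite (bigID (fun b => X <= len b)%N) /= -big_filter -/L.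
by move: GL; clear; lia.
Qed.

Let width (X : nat) : R := (Q1 - Q0) * q + (P1 - P0) * e - 2 * X%:R * q * e.

Section OneColumn.
Variable X : nat.
Hypothesis X_le : X%:R * (q' * e - q * e') <= (Q1 - Q0) * q' - (P1 - P0) * e'.

Let win := windows q_gt0 q_le e'_gt0 e_ge covol skew uPP uQP P0E Q0E steep X_le.

Let len_ge b s : (forall c, s <= c < s + X%:Z -> box c b) -> (X <= len b)%N.
Proof.
move=> H; apply: (count_window_ge (a := az) (s := s)) => c /H/box_onto[i [ir ai bi]].
by exists i; rewrite ran ir bi eqxx.
Qed.

(** The offset of a point in the window of its line is a colour below [X]; the
    points outside their window get the colour [X], that is, stay
    uncovered. *)
Lemma F_ge : (M X <= F X)%N.
Proof.
have [s [b1 [b2 [sP b12 _ outside inside]]]] := win.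
pose w i := s (bz i) <= az i < s (bz i) + X%:Z.
pose c i := if w i then absz (az i - s (bz i)) else X.
have cE i : (c i < X)%N = w i.
  rewrite /c; case: ifP => [|_]; last by rewrite ltnn.
  by rewrite /w; clear; lia.
have wE i : w i -> az i = s (bz i) + (c i)%:Z.
  by rewrite /c => wi; rewrite wi; move: wi; rewrite /w; clear; lia.
apply: leq_trans (famF (k := X) (c := c) _); last first.
  move=> i j ir jr ij eij; rewrite cE => wi.
  have wj : w j by rewrite -cE -eij cE.
  have [bij|bji|bij] := ltgtP (bz i) (bz j); last first.
  - move: ij; rewrite (coord_inj ir jr _ bij) ?eqxx //.
    by rewrite (wE _ wi) (wE _ wj) eij bij.
  - right; rewrite /xi /yi (wE _ wi) (wE _ wj) eij.
    exact: offset_class_decreasing bji.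
  - left; rewrite /xi /yi (wE _ wi) (wE _ wj) eij.
    exact: offset_class_decreasing bij.
rewrite (eq_count cE) -(sum_count_fiber w lines_uniq lines_all).
apply: leq_sum => b _.
have [bin|bout] := boolP (b1 <= b <= b2).
  apply: leq_trans (geq_minr _ _) _.
  apply: (count_window_ge (a := az) (s := s b)) => d hd.
  have [i [ir ai bi]] := box_onto (inside _ _ bin hd).
  by exists i; rewrite ran ir /w bi ai hd eqxx.
apply: leq_trans (geq_minl _ _) _; rewrite /len -!size_filter.
rewrite (eq_in_filter (a2 := fun i => w i && (bz i == b))) // => i.
rewrite ran => ir /=; case: eqP => [bi|]; rewrite ?andbF //.
rewrite andbT /w; apply/esym; apply: outside; last exact: box_in.
by rewrite bi; move: bout; rewrite negb_and -!ltNge.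
Qed.

(** A cell in column [X + 1] and row [y + 1] gives [y + 1] lines with more than
    [X] points; by [short_line] their indices lie in an open interval of length
    [width X]. *)
Lemma column_upper y : cell X y -> y.+1%:R <= width X + 1.
Proof.
move=> /cell_in h; have := leq_trans h (F_le X.+1); rewrite MS.
have -> : F X = M X by apply/eqP; rewrite eqn_leq F_le F_ge.
rewrite leq_add2l -size_filter; set L := [seq b <- lines | _] => yL.
apply: le_trans (_ : (size L)%:R <= _); first by rewrite ler_nat.
have -> : width X + 1 = (e * (P1 - q * X%:R) - q * Q0) -
    (e * P0 - q * (Q1 - e * X%:R)) + 1 by rewrite /width; ring.
apply: size_ints_in; first by rewrite filter_uniq.
  by rewrite -size_eq0 -lt0n (leq_trans _ yL).
move=> b; rewrite mem_filter => /andP[Xb _].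
rewrite !ltNge -negb_or; apply/negP => /(short_line q_gt0 e'_gt0 e_ge covol uPP uQP).
move=> [s sb]; move: Xb; rewrite ltnNge => /negP; apply.
apply: (count_window_le (a := az) (s := s)); first exact: iota_uniq.
  move=> i j; rewrite !mem_filter !ran => /andP[/eqP bi ir] /andP[/eqP bj jr] a_ij.
  by apply: coord_inj; rewrite // bi.
by move=> i; rewrite ran => ir /eqP bi; apply: sb; rewrite -bi; apply: box_in.
Qed.

(** The lines [b1 .. b2] of [windows] have at least [X] points each, and there
    are at least [width X - 1] of them. *)
Lemma column_lower y : (0 < X)%N -> y.+1%:R <= width X - 1 \/ y = 0%N ->
  cell X.-1 y.
Proof.
move=> X0 hy; apply: contraT => /cell_out; rewrite prednK // => h.
have [s [b1 [b2 [sP b12 W _ inside]]]] := win.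
have : (M X <= M X.-1 + y)%N.
  by apply: leq_trans F_ge _; apply: leq_trans h _; rewrite leq_add2r F_le.
rewrite -{1}(prednK X0) MS leq_add2l leqNgt => /negP; case.
have yb : y.+1%:Z <= b2 - b1 + 1.
  case: hy => [hy|->]; last by move: b12; clear; lia.
  by rewrite -(ler_int R); apply: le_trans W.
pose block : seq int := [seq b1 + k%:Z | k <- iota 0 y.+1].
apply: leq_trans (_ : (size block <= _)%N); first by rewrite size_map size_iota.
rewrite -size_filter; apply: uniq_leq_size.
  by rewrite map_inj_uniq ?iota_uniq // => k l /addrI[].
move=> b /mapP[k]; rewrite mem_iota => /andP[_ ky] ->.
have bin : b1 <= b1 + k%:Z <= b2 by move: yb ky; clear; lia.
have lb : (X <= len (b1 + k%:Z))%N.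
  by apply: (len_ge (s := s (b1 + k%:Z))) => c; apply: inside.
rewrite mem_filter prednK // lb mem_undup /=.
have : has (fun i => bz i == b1 + k%:Z) (iota 1 n).
  by rewrite has_count (leq_trans X0).
by case/hasP => i ir /eqP <-; apply: map_f.
Qed.

End OneColumn.

End Columns.

(** * Convergents and their errors *)
Section Continuants.
Implicit Types (u : nat -> int) (k : nat).

Fixpoint cnum u k : int :=
  if k is k1.+1 then
    if k1 is k2.+1 then u k * cnum u k1 + cnum u k2 else u 1 * u 0 + 1
  else u 0.

Fixpoint cden u k : int :=
  if k is k1.+1 then
    if k1 is k2.+1 then u k * cden u k1 + cden u k2 else u 1
  else 1.

Lemma cnumSS u k : cnum u k.+2 = u k.+2 * cnum u k.+1 + cnum u k.
Proof. by []. Qed.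

Lemma cdenSS u k : cden u k.+2 = u k.+2 * cden u k.+1 + cden u k.
Proof. by []. Qed.

(** Continuants are built from the last quotient on, whereas [cfrac] peels off
    the first one; this identity reconciles the two recursions. *)
Lemma continuant_shift u k :
  cnum u k.+1 = u 0 * cnum (u \o succn) k + cden (u \o succn) k /\
  cden u k.+1 = cnum (u \o succn) k.
Proof.
suff: (cnum u k.+1 = u 0 * cnum (u \o succn) k + cden (u \o succn) k /\
       cden u k.+1 = cnum (u \o succn) k) /\
      (cnum u k.+2 = u 0 * cnum (u \o succn) k.+1 + cden (u \o succn) k.+1 /\
       cden u k.+2 = cnum (u \o succn) k.+1) by case.
elim: k => [|k [[IHn IHd] [IHn1 IHd1]]].
  by rewrite /=; split; split => //; ring.
split; first by split.
rewrite (cnumSS u k.+1) (cdenSS u k.+1) IHn1 IHd1 IHn IHd.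
by rewrite (cnumSS (u \o succn) k) (cdenSS (u \o succn) k) /=; split; ring.
Qed.

Definition pos_tail u := forall k, 1 <= u k.+1.

Lemma cden_mono u k : pos_tail u -> 1 <= cden u k <= cden u k.+1.
Proof.
move=> up; elim: k => [|k /andP[h1 h2]]; first exact: up.
rewrite (le_trans h1 h2) andTb cdenSS; have h3 := up k.+1.
apply: le_trans (_ : 1 * cden u k.+1 <= _); first by rewrite mul1r.
apply: ler_wpDr; first by rewrite (le_trans _ h1).
by rewrite ler_wpM2r // (le_trans _ h2) // (le_trans _ h1).
Qed.

Lemma continuant_det u k : cnum u k.+1 * cden u k - cnum u k * cden u k.+1 = (-1) ^+ k.
Proof.
elim: k => [|k IH]; first by rewrite /= expr0; ring.
by rewrite cnumSS cdenSS exprS -IH; ring.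
Qed.

Lemma cfrac_continuants u k : pos_tail u ->
  cfrac (u 0) [seq u j | j <- iota 1 k] = (cnum u k)%:~R / (cden u k)%:~R.
Proof.
elim: k u => [|k IH] u up; first by rewrite /= divr1.
have up' : pos_tail (u \o succn) by move=> j; apply: up.
have -> : cfrac (u 0) [seq u j | j <- iota 1 k.+1] = (u 0)%:~R +
    (cfrac ((u \o succn) 0) [seq (u \o succn) j | j <- iota 1 k])^-1.
  by rewrite /= -[2%N]/(1 + 1)%N iotaDl -map_comp.
have [-> ->] := continuant_shift u k; rewrite (IH _ up').
have h : (cnum (u \o succn) k)%:~R != 0 :> rat.
  rewrite intr_eq0 -(continuant_shift u k).2; apply: lt0r_neq0.
  by have /andP[h1 h2] := cden_mono k up; apply: lt_le_trans (le_trans h1 h2).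
by rewrite invf_div intrD intrM; field.
Qed.

Lemma continuant_coprime u k : coprime `|cnum u k| `|cden u k|.
Proof.
rewrite -[coprime _ _]/(coprimez _ _); apply/coprimezP.
exists (- (-1) ^+ k * cden u k.+1, (-1) ^+ k * cnum u k.+1) => /=.
have := continuant_det u k; set s := (-1) ^+ k => h.
have s2 : s * s = 1 by rewrite -expr2 sqrr_sign.
transitivity (s * (cnum u k.+1 * cden u k - cnum u k * cden u k.+1)).
  by ring.
by rewrite h s2.
Qed.

End Continuants.

Section ConvergentErrors.
Variables (R : realType) (alpha : R).
Hypotheses (alpha01 : 0 < alpha < 1) (alpha_irr : irrational alpha).

Let a := partial_quotient alpha.
Let y := complete_quotient alpha.

Definition signed_err k : R := alpha * (cden a k)%:~R - (cnum a k)%:~R.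

Lemma irrational_linear (p q : int) : q != 0 -> alpha * q%:~R - p%:~R != 0.
Proof.
move=> q0; apply/negP; rewrite subr_eq0 => /eqP e; apply: alpha_irr.
exists (p%:~R / q%:~R) => //; rewrite fmorph_div /= !ratr_int -e.
by rewrite mulfK // intr_eq0.
Qed.

Let a_0 : a 0 = 0.
Proof.
case/andP: alpha01 => a0 a1; apply/eqP; rewrite /a /partial_quotient /=.
by rewrite floor_eq add0r ltW.
Qed.

Let y_frac k : y k.+1 = (y k - (a k)%:~R)^-1. Proof. by []. Qed.

Let frac_itv k : 0 <= y k - (a k)%:~R < 1.
Proof.
rewrite subr_ge0 /a /partial_quotient floor_le /= ltrBlDr addrC.
by have := floorD1_gt (y k); rewrite intrD.
Qed.

Let errS k : signed_err k.+2 = (a k.+2)%:~R * signed_err k.+1 + signed_err k.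
Proof.
by rewrite /signed_err cnumSS cdenSS !intrD !intrM; ring.
Qed.

Let a_pos_of k : y k - (a k)%:~R != 0 -> 1 < y k.+1 /\ 1 <= a k.+1.
Proof.
move=> nz; have /andP[f0 f1] := frac_itv k.
have y1 : 1 < y k.+1 by rewrite y_frac invf_gt1 // lt_def nz.
by split=> //; rewrite /a /partial_quotient floor_ge_int ltW.
Qed.

(** The parts support one another: the errors are nonzero because the
    denominators are positive and [alpha] is irrational; hence the next
    fractional part is nonzero and the next partial quotient positive. *)
Let err_quotient k : [/\ 1 <= cden a k <= cden a k.+1, y k - (a k)%:~R != 0,
  y k.+1 - (a k.+1)%:~R != 0 &
  y k.+2 * signed_err k.+1 = - signed_err k].
Proof.
elim: k => [|k [/andP[d0 d1] f0 f1 IH]].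
  have nz0 : y 0%N - (a 0%N)%:~R != 0.
    by have := irrational_linear (a 0%N) (oner_neq0 _); rewrite mulr1z mulr1.
  have [_ a1] := a_pos_of nz0.
  have e0 : y 1%N * signed_err 0 = 1.
    by rewrite y_frac /signed_err /= mulr1 mulVf.
  have e1 : signed_err 1 = - (y 1%N - (a 1%N)%:~R) * signed_err 0.
    rewrite mulNr mulrBl e0 /signed_err /= !intrD !intrM mulr1z; ring.
  have nz1 : y 1%N - (a 1%N)%:~R != 0.
    have : signed_err 1 != 0 by apply: irrational_linear; rewrite lt0r_neq0 // (lt_le_trans _ a1).
    by rewrite e1 mulNr oppr_eq0 mulf_eq0 negb_or => /andP[].
  by split=> //; rewrite y_frac e1 mulNr mulrN mulKf.
have [_ a2] := a_pos_of f1.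
have d2 : cden a k.+1 <= cden a k.+2.
  rewrite cdenSS; apply: le_trans (_ : 1 * cden a k.+1 <= _); first by rewrite mul1r.
  apply: ler_wpDr; first by rewrite (le_trans _ d0).
  by rewrite ler_wpM2r // (le_trans _ d1) // (le_trans _ d0).
have e2 : signed_err k.+2 = - (y k.+2 - (a k.+2)%:~R) * signed_err k.+1.
  by rewrite errS mulNr mulrBl IH; ring.
have nz2 : y k.+2 - (a k.+2)%:~R != 0.
  have : signed_err k.+2 != 0.
    by apply: irrational_linear; rewrite lt0r_neq0 // (lt_le_trans _ (le_trans d0 (le_trans d1 d2))).
  by rewrite e2 mulNr oppr_eq0 mulf_eq0 negb_or => /andP[].
split=> //; first by rewrite (le_trans d0 d1).
by rewrite (y_frac k.+2) e2 mulNr mulrN mulKf.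
Qed.

Let a_tail : pos_tail a.
Proof. by move=> k; have [_ nz _ _] := err_quotient k; have [] := a_pos_of nz. Qed.

Lemma conv_numE k : conv_num alpha k = cnum a k.
Proof.
rewrite /conv_num /convergent (cfrac_continuants _ a_tail) coprimeq_num ?continuant_coprime //.
have /andP[h _] := cden_mono k a_tail.
by rewrite gtr0_sg ?mul1r // (lt_le_trans _ h).
Qed.

Lemma conv_denE k : conv_den alpha k = cden a k.
Proof.
rewrite /conv_den /convergent (cfrac_continuants _ a_tail) coprimeq_den ?continuant_coprime //.
have /andP[h _] := cden_mono k a_tail.
by rewrite gt_eqF ?(lt_le_trans _ h) // ger0_norm // (le_trans _ h).
Qed.

(** Consecutive errors have the quotient [- y (k + 2)], where the complete
    quotient [y (k + 2)] exceeds [1]: they alternate in sign and decrease. *)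
Lemma signed_err_pos k : 0 < (-1) ^+ k * signed_err k.
Proof.
elim: k => [|k IH].
  by rewrite /signed_err /= a_0 subr0 mulr1 mul1r; case/andP: alpha01.
have [_ _ nz e] := err_quotient k; have [y2 _] := a_pos_of nz.
have y0 : 0 < y k.+2 := lt_trans ltr01 y2.
by rewrite exprS mulN1r mulNr -mulrN -(pmulr_rgt0 _ y0) mulrCA mulrN e opprK.
Qed.

Lemma signed_err_decr k : `|signed_err k.+1| < `|signed_err k|.
Proof.
have [_ _ nz e] := err_quotient k; have [y2 _] := a_pos_of nz.
have y0 : 0 < y k.+2 := lt_trans ltr01 y2.
have h : 0 < `|signed_err k.+1|.
  by rewrite normr_gt0; apply: contraTneq (signed_err_pos k.+1) => ->; rewrite mulr0 ltxx.
rewrite -(normrN (signed_err k)) -e normrM (gtr0_norm y0).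
by rewrite ltr_pMl.
Qed.

Lemma conv_errE k : (conv_den alpha k)%:~R * conv_err alpha k =
  (-1) ^+ k * (alpha * (conv_den alpha k)%:~R - (conv_num alpha k)%:~R).
Proof.
have d0 : 0 < (conv_den alpha k)%:~R :> R.
  by rewrite ltr0z conv_denE; have /andP[h _] := cden_mono k a_tail; apply: lt_le_trans h.
rewrite -{1}(gtr0_norm d0) /conv_err -normrM mulrBr mulrCA mulfV ?gt_eqF // mulr1.
rewrite [_ * alpha]mulrC conv_denE conv_numE -/(signed_err k).
by rewrite -(ger0_norm (ltW (signed_err_pos k))) normrM normrX normrN1 expr1n mul1r.
Qed.

(** The vectors [(q k, e k)] and [(q k.+1, - e k.+1)] form a reduced basis of a
    lattice of covolume [1]. *)
Lemma convergent_pair k :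
  let q j := (conv_den alpha j)%:~R : R in
  let e j := q j * conv_err alpha j in
  [/\ 1 <= q k, q k <= q k.+1, 0 < e k.+1, e k.+1 < e k &
    q k.+1 * e k + q k * e k.+1 = 1].
Proof.
have /andP[d1 d2] := cden_mono k a_tail.
rewrite /= !conv_errE !conv_denE !conv_numE -!/(signed_err _); split.
- by rewrite ler1z.
- by rewrite ler_int.
- exact: signed_err_pos.
- rewrite -[ltLHS](ger0_norm (ltW (signed_err_pos _))).
  rewrite -[ltRHS](ger0_norm (ltW (signed_err_pos _))).
  by rewrite !normrM !normrX !normrN1 !expr1n !mul1r signed_err_decr.
- rewrite /signed_err.
  have := congr1 (fun z : int => z%:~R : R) (continuant_det a k).
  rewrite /= intrB !intrM rmorphXn /= intrN mulr1z => h.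
  have h2 : (-1) ^+ k * (-1) ^+ k = 1 :> R by rewrite -expr2 sqrr_sign.
  rewrite exprS; transitivity ((-1) ^+ k * ((cnum a k.+1)%:~R * (cden a k)%:~R -
    (cnum a k)%:~R * (cden a k.+1)%:~R) : R); first by ring.
  by rewrite h h2.
Qed.

Lemma convergent_det k :
  conv_num alpha k.+1 * conv_den alpha k - conv_num alpha k * conv_den alpha k.+1
  = (-1) ^+ k.
Proof. by rewrite !conv_denE !conv_numE continuant_det. Qed.

End ConvergentErrors.

(** * Cells and holes near the line *)
Section Near.
Variables (R : realType) (cell : nat -> nat -> bool) (x0 y0 m : R).
Hypotheses (m_ge0 : 0 <= m) (m_le2 : m <= 2) (x0_gt0 : 0 < x0) (y0_gt0 : 0 < y0).
Let W (x : R) : R := y0 + m * (x0 - x).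
Hypothesis colU : forall X y : nat, X%:R <= x0 -> cell X y -> y.+1%:R <= W X%:R + 1.
Hypothesis colL : forall X y : nat, (0 < X)%N -> X%:R <= x0 ->
  y.+1%:R <= W X%:R - 1 \/ y = 0%N -> cell X.-1 y.
Hypothesis rowL : forall Y : nat, (0 < Y)%N -> Y%:R <= y0 -> cell 0 Y.-1.
Hypothesis cell00 : cell 0 0.

(** For [1 <= x0] take the column [X] next to [x]: moving by at most [1]
    changes [W] by at most [2], and the estimate of the height and the rounding
    cost [1] each.  For [x0 < 1] the first column need not satisfy the estimate,
    and a row bound provides the cell, or the corner cell if also [y0 < 1]. *)
Lemma near_cell (x : R) : 0 <= x <= x0 -> exists X Y : nat,
  [/\ cell X Y, `|x - X.+1%:R| <= 1 & `|W x - Y.+1%:R| <= 4].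
Proof.
have [m0 m2 x0p y0p] := And4 m_ge0 m_le2 x0_gt0 y0_gt0; move=> /andP[x_ge0 x_le].
have /andP[mx mx2] : 0 <= m * (x0 - x) <= 2 * (x0 - x).
  by rewrite mulr_ge0 ?subr_ge0 //= ler_wpM2r ?subr_ge0.
have [x01|x01] := leP 1 x0.
  pose X := maxn 1 (Num.truncn x).
  have /andP[t1 t2] := truncn_itv x_ge0.
  have X0 : (0 < X)%N by rewrite leq_max.
  have Xx0 : X%:R <= x0 by rewrite /X; case: leqP => _ //; apply: le_trans t1 x_le.
  have Xx : `|x - X%:R| <= 1.
    rewrite -natr1 in t2; rewrite ler_norml /X; case: leqP => h; first by apply/andP; split; lra.
    move: h; rewrite ltnS leqn0 => /eqP t0; rewrite t0 in t2.
    by apply/andP; split; lra.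
  have X_le : X%:R <= x + 1 by move: Xx; rewrite ler_norml => /andP[]; lra.
  have WX : W x - 2 <= W X%:R.
    have : m * (X%:R - x) <= 2.
      apply: le_trans (_ : m * 1 <= _); last by rewrite mulr1.
      by rewrite ler_wpM2l // lerBlDl.
    rewrite /W; lra.
  have W0 : 0 < W x by rewrite /W; lra.
  exists X.-1; rewrite prednK //.
  have [w5|w5] := ltP (W x) 5.
    exists 0%N; split=> //; first by apply: colL => //; right.
    by rewrite ler_norml; apply/andP; split; lra.
  have w3 : 0 <= W x - 3 by lra.
  have /andP[s1 s2] := truncn_itv w3.
  exists (Num.truncn (W x - 3)).-1; split=> //.
    apply: colL => //; left; rewrite prednK ?truncn_gt0; lra.
  rewrite prednK ?truncn_gt0; last lra.
  by rewrite -[X in _ < X]natr1 in s2; rewrite ler_norml; apply/andP; split; lra.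
exists 0%N; have [y01|y01] := leP 1 y0.
  have /andP[s1 s2] := truncn_itv (ltW y0_gt0).
  exists (Num.truncn y0).-1; rewrite prednK ?truncn_gt0 //; split.
  - by apply: rowL => //; rewrite truncn_gt0.
  - by rewrite ler_norml; apply/andP; split; lra.
  - by rewrite -natr1 in s2; rewrite ler_norml /W; apply/andP; split; lra.
exists 0%N; split=> //; rewrite ler_norml; first by apply/andP; split; lra.
by rewrite /W; apply/andP; split; lra.
Qed.

(** The column [X + 1] just right of the integer part of [x] has at most
    [W X + 1] cells, and [W X] exceeds [W x] by at most [2]. *)
Lemma near_hole (x : R) : 0 <= x <= x0 -> exists X Y : nat,
  [/\ ~~ cell X Y, `|x - (X%:R + 2^-1)| <= 1 & `|W x - (Y%:R + 2^-1)| <= 4].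
Proof.
have [m0 m2 x0p y0p] := And4 m_ge0 m_le2 x0_gt0 y0_gt0; move=> /andP[x_ge0 x_le].
have mx : 0 <= m * (x0 - x) by rewrite mulr_ge0 ?subr_ge0 //=.
have /andP[t1 t2] := truncn_itv x_ge0; set X := Num.truncn x in t1 t2.
rewrite -natr1 in t2.
have /andP[WX WX2] : W x <= W X%:R <= W x + 2.
  have /andP[h h2] : 0 <= m * (x - X%:R) <= 2.
    rewrite mulr_ge0 ?subr_ge0 //=; apply: le_trans (_ : m * 1 <= _); last by rewrite mulr1.
    by rewrite ler_wpM2l //; lra.
  rewrite /W; apply/andP; split; lra.
have W0 : 0 <= W X%:R by apply: le_trans WX; rewrite /W; lra.
have /andP[s1 s2] := truncn_itv W0; set Y := Num.truncn _ in s1 s2.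
rewrite -natr1 in s2; have Y1 : Y.+1%:R = Y%:R + 1 :> R by rewrite natr1.
exists X, Y.+1; split.
- apply/negP => /colU; rewrite -natr1 Y1 => /(_ (le_trans t1 x_le)).
  by move: s2; lra.
- by rewrite ler_norml; apply/andP; split; lra.
- by rewrite Y1 ler_norml; apply/andP; split; lra.
Qed.

End Near.

(** * Distance to the boundary of the planar set *)
Section Boundary.
Variable R : realType.

(** Otherwise the part of the segment in the interior of [A] would be open and
    closed in it. *)
Lemma segment_meets_boundary (A : set (R * R)) (u v : R * R) : A u -> ~ A v ->
  exists2 t : R, 0 <= t <= 1 &
    (closure A `\` interior A) (u.1 + t * (v.1 - u.1), u.2 + t * (v.2 - u.2)).
Proof.
move=> Au Av; pose g (t : R) : R * R := (u.1 + t * (v.1 - u.1), u.2 + t * (v.2 - u.2)).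
have g0 : g 0 = u by rewrite /g !mul0r !addr0 -surjective_pairing.
have g1 : g 1 = v by rewrite /g !mul1r !subrKC -surjective_pairing.
pose I : set R := `[0, 1]%classic.
have gc : continuous g.
  have affine (a b : R) : continuous (fun t : R => a + t * b).
    move=> t; apply: (@cvgD _ R^o); first exact: cvg_cst.
    by apply: (@cvgM R); [exact: cvg_id|exact: cvg_cst].
  by move=> t; exact: (cvg_pair (affine u.1 (v.1 - u.1) t) (affine u.2 (v.2 - u.2) t)).
apply: contrapT => nb.
have key t : 0 <= t <= 1 -> closure A (g t) -> interior A (g t).
  by move=> t01 ct; apply: contrapT => nt; apply: nb; exists t.
have h0 : (I `&` g @^-1` (interior A)) 0.
  split; first by rewrite /I /= in_itv /= lexx ler01.
  by apply: key; rewrite ?lexx ?ler01 // g0; apply: subset_closure.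
have E : I `&` g @^-1` (interior A) = I.
  apply: (@segment_connected R 0 1); first by exists 0.
  - exists (g @^-1` (interior A)) => //.
    by apply: open_comp; [move=> t _; exact: gc|exact: open_interior].
  - exists (g @^-1` (closure A)).
      by apply: preimage_closed; [move=> t _; exact: gc|exact: closed_closure].
    apply/seteqP; split=> t /= [t01 h]; split=> //.
      by apply: subset_closure; apply: interior_subset.
    by apply: key.
apply: Av; rewrite -g1; apply: interior_subset.
have : I 1 by rewrite /I /= in_itv /= lexx ler01.
by rewrite -E => -[].
Qed.

Lemma planar_setP (la : seq nat) (X Y : nat) : (X < nth 0 la Y)%N ->
  planar_set la (X.+1%:R : R, Y.+1%:R : R).
Proof.
move=> h; have Yla : (Y < size la)%N.
  by rewrite ltnNge; apply/negP => /(nth_default 0) e; rewrite e in h.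
exists Y.+1; first by rewrite /= Yla.
exists X.+1 => //=; split; rewrite in_itv /= lexx andbT lerBlDr; lra.
Qed.

(** Centres of unit squares are used, since the corners of an uncovered square
    may belong to the closed set. *)
Lemma planar_setN (la : seq nat) (X Y : nat) : sorted geq la ->
  ~~ (X < nth 0 la Y)%N -> ~ planar_set la (X%:R + 2^-1 : R, Y%:R + 2^-1 : R).
Proof.
move=> sla /negP h [k /= /andP[k1 ks] [l /= /andP[l1 ll]]].
rewrite !in_itv /= => -[/andP[_ hl] /andP[_ hk]]; apply: h.
have Xl : (X < l)%N.
  by rewrite -(ltr_nat R); apply: lt_le_trans hl; rewrite ltrDl invr_gt0.
have Yk : (Y < k)%N.
  by rewrite -(ltr_nat R); apply: lt_le_trans hk; rewrite ltrDl invr_gt0.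
apply: leq_trans Xl (leq_trans ll _).
have geq_trans : transitive geq by move=> b a c ab bc; apply: leq_trans bc ab.
have geq_refl : reflexive geq by move=> a; apply: leqnn.
apply: (sorted_leq_nth geq_trans geq_refl 0 sla); rewrite ?inE; lia.
Qed.

(** Every point of the segment from the cell corner to the hole is as close to
    [P], coordinate by coordinate, as its ends are; both ends have positive
    coordinates, so the boundary point found is off the axes. *)
Lemma dist_to_boundary_lt (la : seq nat) (P : R * R) (X Y X' Y' : nat)
    (d1 d2 r : R) :
  sorted geq la -> (X < nth 0 la Y)%N -> ~~ (X' < nth 0 la Y')%N ->
  `|P.1 - X.+1%:R| <= d1 -> `|P.2 - Y.+1%:R| <= d2 ->
  `|P.1 - (X'%:R + 2^-1)| <= d1 -> `|P.2 - (Y'%:R + 2^-1)| <= d2 ->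
  0 < r -> d1 ^+ 2 + d2 ^+ 2 < r ^+ 2 ->
  (dist_to P (planar_boundary la) < r%:E)%E.
Proof.
move=> sla c n c1 c2 n1 n2 r0 dr.
have [t /andP[t0 t1] bt] := segment_meets_boundary (planar_setP c) (planar_setN sla n).
set z := (_, _) in bt.
have conv (x a b d : R) : `|x - a| <= d -> `|x - b| <= d -> `|x - (a + t * (b - a))| <= d.
  move=> xa xb; have -> : x - (a + t * (b - a)) = (1 - t) * (x - a) + t * (x - b) by ring.
  apply: le_trans (ler_normD _ _) _; rewrite !normrM (ger0_norm t0) ger0_norm ?subr_ge0 //.
  have -> : d = (1 - t) * d + t * d by ring.
  by apply: lerD; apply: ler_wpM2l; rewrite ?subr_ge0.
have pos (X1 X2 : nat) : 0 < X1.+1%:R + t * (X2%:R + 2^-1 - X1.+1%:R) :> R.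
  have h1 : 0 < X1.+1%:R :> R by rewrite ltr0n.
  have h2 : 0 < X2%:R + 2^-1 :> R by rewrite ltr_wpDl // invr_gt0.
  have -> : X1.+1%:R + t * (X2%:R + 2^-1 - X1.+1%:R) =
    (1 - t) * X1.+1%:R + t * (X2%:R + 2^-1) :> R by ring.
  case: (ltgtP t 0) t0 => // [t0' _|-> _]; last by rewrite subr0 mul1r mul0r addr0.
  by rewrite ltr_wpDl // ?mulr_gt0 // mulr_ge0 ?subr_ge0 // ltW.
apply: le_lt_trans (_ : ((euclid_dist P z)%:E < r%:E)%E).
  by apply: ereal_inf_lbound; exists z => //; split=> //; split; apply: pos.
rewrite lte_fin /euclid_dist -(ltr_pXn2r (n := 2)) ?nnegrE ?sqrtr_ge0 ?(ltW r0) //.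
rewrite sqr_sqrtr ?addr_ge0 ?sqr_ge0 //; apply: le_lt_trans dr.
have sq (a d : R) : `|a| <= d -> a ^+ 2 <= d ^+ 2.
  by move=> ad; rewrite -real_normK ?num_real // lerXn2r ?nnegrE // (le_trans _ ad).
by apply: lerD; apply: sq; apply: conv.
Qed.

End Boundary.

(** * The points of the permutation as lattice points *)

Lemma upper_le (R : realType) (M : R) : upper M (fun r => r <= M).
Proof.
by split=> // [r s rs sM|r /ltW//]; apply: le_trans rs sM.
Qed.

Lemma upper_lt (R : realType) (M : R) : upper M (fun r => r < M).
Proof.
by split=> // [r s rs sM|r /ltW//]; apply: le_lt_trans rs sM.
Qed.

Section FractionalParts.
Variables (R : realType) (alpha : R).
Hypothesis alpha_irr : irrational alpha.

Lemma frac_mul_itv i : (0 < i)%N -> 0 < frac_mul alpha i < 1.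
Proof.
move=> i0; rewrite /frac_mul; have := floorD1_gt (alpha * i%:R).
have := floor_le (alpha * i%:R); rewrite -subr_ge0 intrD mulr1z => h1 h2.
rewrite lt_def h1 andbT ltrBlDr [1 + _]addrC h2 andbT.
have i0' : i%:Z != 0 by rewrite eqz_nat -lt0n.
exact: (irrational_linear alpha_irr (Num.floor (alpha * i%:R)) i0').
Qed.

Lemma frac_mul_inj i j : frac_mul alpha i = frac_mul alpha j -> i = j.
Proof.
move=> e; apply/eqP; case: (eqVneq (i%:Z - j%:Z) 0) => [/subr0_eq[->]//|nz].
have := irrational_linear alpha_irr
  (Num.floor (alpha * i%:R) - Num.floor (alpha * j%:R)) nz.
rewrite !intrB; move: e; rewrite /frac_mul => /eqP; rewrite -subr_eq0 => /eqP e.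
by case/eqP; rewrite -{}[RHS]e; have -> : (i%:Z)%:~R = i%:R :> R by []; have -> : (j%:Z)%:~R = j%:R :> R by []; ring.
Qed.

End FractionalParts.

Lemma intr_dot (R : realType) (a b c d m : int) : a * b + c * d = m ->
  a%:~R * b%:~R + c%:~R * d%:~R = m%:~R :> R.
Proof. by move=> <-; rewrite intrD !intrM. Qed.

Section Shape.
Variables (R : realType) (alpha : R) (n k : nat).
Hypotheses (alpha01 : 0 < alpha < 1) (alpha_irr : irrational alpha).

Let f := frac_mul alpha.
Let s : int := (-1) ^+ k.
Let q : R := (conv_den alpha k)%:~R.
Let q' : R := (conv_den alpha k.+1)%:~R.
Let e : R := q * conv_err alpha k.
Let e' : R := q' * conv_err alpha k.+1.

(* These say that [n] lies between the inverse errors of two consecutive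
   convergents. *)
Hypotheses (n_lb : q < n%:R * e) (n_ub : n%:R * e' < q').

Variables (F G : nat -> nat) (cell : nat -> nat -> bool).
Hypothesis FG : forall x j, (F x + G j <= n + j * x)%N.
Hypothesis F_in : forall x y, cell x y -> (F x + y.+1 <= F x.+1)%N.
Hypothesis F_out : forall x y, ~~ cell x y -> (F x.+1 <= F x + y)%N.
Hypothesis G_in : forall x y, cell x y -> (G y + x.+1 <= G y.+1)%N.
Hypothesis G_out : forall x y, ~~ cell x y -> (G y.+1 <= G y + x)%N.
Hypothesis famF : forall j (c : nat -> nat),
  (forall a b, (0 < a)%N -> (a < b <= n)%N -> c a = c b -> (c a < j)%N ->
     s%:~R * f b < s%:~R * f a) ->
  (count (fun a => c a < j) (iota 1 n) <= F j)%N.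
Hypothesis famG : forall j (c : nat -> nat),
  (forall a b, (0 < a)%N -> (a < b <= n)%N -> c a = c b -> (c a < j)%N ->
     s%:~R * f a < s%:~R * f b) ->
  (count (fun a => c a < j) (iota 1 n) <= G j)%N.
Hypothesis cell00 : cell 0 0.

Let pI := conv_num alpha k.
Let pI' := conv_num alpha k.+1.
Let qI := conv_den alpha k.
Let qI' := conv_den alpha k.+1.
Let fl (i : nat) : int := Num.floor (alpha * i%:R).

(** Coordinates of [(i, (-1)^k f i)] in the basis [(q, e)], [(q', - e')], by
    Cramer's rule. *)
Definition az (i : nat) : int := s * (i%:Z * pI' - fl i * qI').
Definition bz (i : nat) : int := s * (qI * fl i - pI * i%:Z).

Let ss : s * s = 1. Proof. by rewrite -expr2 sqrr_sign. Qed.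
Let det : pI' * qI - pI * qI' = s. Proof. exact: convergent_det. Qed.

Let azbz_q i : az i * qI + bz i * qI' = i%:Z.
Proof.
transitivity (s * (pI' * qI - pI * qI') * i%:Z); first by rewrite /az /bz; ring.
by rewrite det ss mul1r.
Qed.

Let azbz_p i : az i * pI + bz i * pI' = fl i.
Proof.
transitivity (s * (pI' * qI - pI * qI') * fl i); first by rewrite /az /bz; ring.
by rewrite det ss mul1r.
Qed.

Let eE : e = s%:~R * (alpha * q - pI%:~R).
Proof. by rewrite /e /q (conv_errE alpha01 alpha_irr) /s rmorphXn /= intrN. Qed.

Let e'E : e' = - s%:~R * (alpha * q' - pI'%:~R).
Proof.
rewrite /e' /q' (conv_errE alpha01 alpha_irr) /s rmorphXn /= intrN.
by rewrite exprS mulN1r.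
Qed.

Let q_ge1 : 1 <= q. Proof. by have [] := convergent_pair alpha01 alpha_irr k. Qed.
Let q_gt0 : 0 < q. Proof. exact: lt_le_trans q_ge1. Qed.
Let q_le : q <= q'. Proof. by have [] := convergent_pair alpha01 alpha_irr k. Qed.
Let e'_gt0 : 0 < e'. Proof. by have [] := convergent_pair alpha01 alpha_irr k. Qed.
Let e_gt : e' < e. Proof. by have [] := convergent_pair alpha01 alpha_irr k. Qed.
Let e_gt0 : 0 < e. Proof. exact: lt_trans e_gt. Qed.
Let q'_gt0 : 0 < q'. Proof. exact: lt_le_trans q_le. Qed.
Let covol : q' * e + q * e' = 1.
Proof. by have [] := convergent_pair alpha01 alpha_irr k. Qed.

Let skew : q * e' < q' * e.
Proof.
apply: le_lt_trans (_ : q' * e' < _); first by rewrite ler_wpM2r // ltW.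
by rewrite ltr_pM2l.
Qed.

Let px_i i : px q q' (az i) (bz i) = i%:R.
Proof.
have h := intr_dot R (azbz_q i); have -> : i%:R = (i%:Z)%:~R :> R by [].
by rewrite -h /px /q /q' -/qI -/qI'; ring.
Qed.

Let py_i i : py e e' (az i) (bz i) = s%:~R * f i.
Proof.
have h := intr_dot R (azbz_p i).
by rewrite /f /frac_mul -/(fl i) -h -(px_i i) /py /px eE e'E; ring.
Qed.

(* The flip of the vertical axis for odd [k] puts the box at heights
   [-1 .. 0]. *)
Let Q0 : R := if odd k then -1 else 0.

Let s_odd : s%:~R = if odd k then -1 else 1 :> R.
Proof. by rewrite /s rmorphXn /= intrN mulr1z -signr_odd; case: (odd k). Qed.


Let Q1 : R := Q0 + 1.

Let py_itv i : (0 < i)%N -> Q0 < py e e' (az i) (bz i) < Q1.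
Proof.
move=> i0; have /andP[f0 f1] := frac_mul_itv alpha_irr i0.
by rewrite py_i s_odd /Q1 /Q0 /f; case: (odd k); apply/andP; split; lra.
Qed.

Let coord_inj i j : (0 < i <= n)%N -> (0 < j <= n)%N ->
  az i = az j -> bz i = bz j -> i = j.
Proof.
move=> _ _ ea eb; apply/eqP; rewrite -eqz_nat -(azbz_q i) -(azbz_q j) ea eb.
exact: eqxx.
Qed.

Let onto (c d : int) : 0 < px q q' c d <= n%:R -> Q0 < py e e' c d < Q1 ->
  exists i, [/\ (0 < i <= n)%N, az i = c & bz i = d].
Proof.
set m := c * qI + d * qI'; set l := c * pI + d * pI'.
have mE : px q q' c d = m%:~R by rewrite -(intr_dot R (erefl m)) /px /q /q' -/qI -/qI'; ring.
have lE : py e e' c d = s%:~R * (alpha * m%:~R - l%:~R).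
  by rewrite -mE -(intr_dot R (erefl l)) /py /px eE e'E; ring.
rewrite mE lE ltr0z => /andP[m0 mn] fr.
have [i mi] : exists i : nat, m = i%:Z by exists (absz m); rewrite gez0_abs // ltW.
have in_ : (0 < i <= n)%N.
  by move: m0 mn; rewrite mi ltz_nat => -> /=; rewrite -[_%:~R]/(i%:R) ler_nat.
have fli : fl i = l.
  apply/eqP; rewrite /fl floor_eq intrD mulr1z -[i%:R]/(i%:Z%:~R) -mi.
  by move: fr; rewrite s_odd /Q1 /Q0; case: (odd k) => /andP[h1 h2]; apply/andP; split; lra.
exists i; split=> //.
  rewrite /az fli -mi /m /l; transitivity (s * (pI' * qI - pI * qI') * c); first by ring.
  by rewrite det ss mul1r.
rewrite /bz fli -mi /m /l; transitivity (s * (pI' * qI - pI * qI') * d); first by ring.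
by rewrite det ss mul1r.
Qed.

Let D : R := q' * e - q * e'.
Let D_gt0 : 0 < D. Proof. by rewrite subr_gt0. Qed.
Let x0 : R := (q' - n%:R * e') / D.
Let y0 : R := (n%:R * e - q) / D.
Let x0_gt0 : 0 < x0. Proof. by rewrite divr_gt0 // subr_gt0. Qed.
Let y0_gt0 : 0 < y0. Proof. by rewrite divr_gt0 // subr_gt0. Qed.

Let widthE (x : R) : y0 + 2 * q * e * (x0 - x) = q + n%:R * e - 2 * x * q * e.
Proof.
have : (y0 + 2 * q * e * x0) * D = (q + n%:R * e) * D.
  have -> : (y0 + 2 * q * e * x0) * D = y0 * D + 2 * q * e * (x0 * D) by ring.
  rewrite /y0 /x0 !divfK ?gt_eqF // /D.
  have h := covol.
  have -> : n%:R * e - q = (n%:R * e - q) * (q' * e + q * e') by rewrite h mulr1.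
  ring.
by move/(mulIf (lt0r_neq0 D_gt0)) => h; rewrite -h; ring.
Qed.

Let width1E X : (Q1 - Q0) * q + (n%:R - 0) * e - 2 * X%:R * q * e =
  y0 + 2 * q * e * (x0 - X%:R).
Proof. by rewrite widthE /Q1; ring. Qed.

Let height1E Y : (n%:R - 0) * e' + (- Q0 - - Q1) * q' - 2 * Y%:R * e' * q' =
  x0 + 2 * e' * q' * (y0 - Y%:R).
Proof.
have : (x0 + 2 * e' * q' * y0) * D = (q' + n%:R * e') * D.
  have -> : (x0 + 2 * e' * q' * y0) * D = x0 * D + 2 * e' * q' * (y0 * D) by ring.
  rewrite /y0 /x0 !divfK ?gt_eqF // /D.
  have h := covol.
  have -> : q' - n%:R * e' = (q' - n%:R * e') * (q' * e + q * e') by rewrite h mulr1.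
  ring.
by move/(mulIf (lt0r_neq0 D_gt0)) => h; rewrite mulrBr addrA h /Q1; ring.
Qed.

Let good_x (X : nat) : X%:R <= x0 ->
  X%:R * (q' * e - q * e') <= (Q1 - Q0) * q' - (n%:R - 0) * e'.
Proof.
rewrite ler_pdivlMr // => h; apply: le_trans h _.
by rewrite /Q1 addrAC subrr add0r mul1r subr0.
Qed.

Let good_y (Y : nat) : Y%:R <= y0 ->
  Y%:R * (e * q' - e' * q) <= (n%:R - 0) * e - (- Q0 - - Q1) * q.
Proof.
rewrite ler_pdivlMr // (mulrC e q') (mulrC e' q) => h; apply: le_trans h _.
have -> : - Q0 - - Q1 = 1 by rewrite /Q1; ring. by rewrite mul1r subr0.
Qed.

(** The quarter turn [(x, y) |-> (- y, x)] maps [a u + b v] to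
    [b (e', q') - a (e, - q)], a combination of the basis with [(e', e, q', q)]
    in place of [(q, q', e, e')]. *)
Let dual_px a b : px e' e b (- a) = - py e e' a b.
Proof. by rewrite /px /py intrN; ring. Qed.

Let dual_py a b : py q' q b (- a) = px q q' a b.
Proof. by rewrite /px /py intrN; ring. Qed.

Let box1 := in_box q q' e e' 0 Q0 (fun r => r <= n%:R) (fun r => r < Q1).
Let box2 := in_box e' e q' q (- Q1) 0 (fun r => r < - Q0) (fun r => r <= n%:R).

Let box1_in i : (0 < i <= n)%N -> box1 (az i) (bz i).
Proof.
move=> /andP[i0 i_n]; have /andP[h1 h2] := py_itv i0.
by rewrite /box1 /in_box px_i ltr0n i0 ler_nat i_n h1 h2.
Qed.

Let box1_onto a b : box1 a b -> exists i, [/\ (0 < i <= n)%N, az i = a & bz i = b].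
Proof.
by move=> /and4P[h1 h2 h3 h4]; apply: onto; [rewrite h1 h2|rewrite h3 h4].
Qed.

Let box2E a b : box2 b (- a) = box1 a b.
Proof.
rewrite /box2 /box1 /in_box dual_px dual_py !ltrN2.
by case: (_ < _); case: (_ <= _); case: (_ < _); case: (_ < _).
Qed.

Let sf_neq a b : (a < b)%N -> s%:~R * f a != s%:~R * f b.
Proof.
move=> ab; apply/negP => /eqP /mulfI h; move: ab.
rewrite (frac_mul_inj alpha_irr (h _)) ?ltnn //.
by rewrite s_odd; case: (odd k); rewrite ?oppr_eq0 oner_eq0.
Qed.

Let fam1 j (c : nat -> nat) :
  (forall a b, (0 < a <= n)%N -> (0 < b <= n)%N -> a != b -> c a = c b ->
     (c a < j)%N ->
     (px q q' (az a) (bz a) <= px q q' (az b) (bz b) /\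
      py e e' (az b) (bz b) < py e e' (az a) (bz a)) \/
     (px q q' (az b) (bz b) <= px q q' (az a) (bz a) /\
      py e e' (az a) (bz a) < py e e' (az b) (bz b))) ->
  (count (fun a => c a < j) (iota 1 n) <= F j)%N.
Proof.
move=> H; apply: famF => a b a0 /andP[ab bn] cab ca.
have := H a b; rewrite a0 (leq_trans (ltnW ab) bn) (ltn_trans a0 ab) bn.
rewrite neq_ltn ab => /(_ isT isT isT cab ca); rewrite !px_i !py_i !ler_nat.
by case=> -[h1 h2] //; rewrite leqNgt ab in h1.
Qed.

Let fam1' j (c : nat -> nat) :
  (forall a b, (0 < a <= n)%N -> (0 < b <= n)%N -> a != b -> c a = c b ->
     (c a < j)%N ->
     (px q q' (az a) (bz a) < px q q' (az b) (bz b) /\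
      py e e' (az a) (bz a) < py e e' (az b) (bz b)) \/
     (px q q' (az b) (bz b) < px q q' (az a) (bz a) /\
      py e e' (az b) (bz b) < py e e' (az a) (bz a))) ->
  (count (fun a => c a < j) (iota 1 n) <= G j)%N.
Proof.
move=> H; apply: famG => a b a0 /andP[ab bn] cab ca.
have := H a b; rewrite a0 (leq_trans (ltnW ab) bn) (ltn_trans a0 ab) bn.
rewrite neq_ltn ab => /(_ isT isT isT cab ca); rewrite !px_i !py_i !ltr_nat.
by case=> -[h1 h2] //; rewrite ltnNge (ltnW ab) in h1.
Qed.

Let fam2 j (c : nat -> nat) :
  (forall a b, (0 < a <= n)%N -> (0 < b <= n)%N -> a != b -> c a = c b ->
     (c a < j)%N ->
     (px e' e (bz a) (- az a) <= px e' e (bz b) (- az b) /\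
      py q' q (bz b) (- az b) < py q' q (bz a) (- az a)) \/
     (px e' e (bz b) (- az b) <= px e' e (bz a) (- az a) /\
      py q' q (bz a) (- az a) < py q' q (bz b) (- az b))) ->
  (count (fun a => c a < j) (iota 1 n) <= G j)%N.
Proof.
move=> H; apply: famG => a b a0 /andP[ab bn] cab ca.
have := H a b; rewrite a0 (leq_trans (ltnW ab) bn) (ltn_trans a0 ab) bn.
rewrite neq_ltn ab => /(_ isT isT isT cab ca).
rewrite !dual_px !dual_py !px_i !py_i !ltr_nat !lerN2.
case=> -[h1 h2] //; first by rewrite ltnNge (ltnW ab) in h2.
by rewrite lt_neqAle sf_neq.
Qed.

Let fam2' j (c : nat -> nat) :
  (forall a b, (0 < a <= n)%N -> (0 < b <= n)%N -> a != b -> c a = c b ->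
     (c a < j)%N ->
     (px e' e (bz a) (- az a) < px e' e (bz b) (- az b) /\
      py q' q (bz a) (- az a) < py q' q (bz b) (- az b)) \/
     (px e' e (bz b) (- az b) < px e' e (bz a) (- az a) /\
      py q' q (bz b) (- az b) < py q' q (bz a) (- az a))) ->
  (count (fun a => c a < j) (iota 1 n) <= F j)%N.
Proof.
move=> H; apply: famF => a b a0 /andP[ab bn] cab ca.
have := H a b; rewrite a0 (leq_trans (ltnW ab) bn) (ltn_trans a0 ab) bn.
rewrite neq_ltn ab => /(_ isT isT isT cab ca).
rewrite !dual_px !dual_py !px_i !py_i !ltr_nat !ltrN2.
by case=> -[h1 h2] //; rewrite ltnNge (ltnW ab) in h2.
Qed.

Let box2_in i : (0 < i <= n)%N -> box2 (bz i) (- az i).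
Proof. by move=> ir; rewrite box2E box1_in. Qed.

Let box2_onto b a : box2 b a -> exists i, [/\ (0 < i <= n)%N, bz i = b & - az i = a].
Proof.
rewrite -[a]opprK box2E => /box1_onto[i [ir ai bi]].
by exists i; rewrite ai bi.
Qed.

Let coord_inj2 i j : (0 < i <= n)%N -> (0 < j <= n)%N ->
  bz i = bz j -> - az i = - az j -> i = j.
Proof. by move=> ir jr eb /oppr_inj ea; apply: coord_inj. Qed.

(* The lower left corner is the origin for even [k] and [(0, -1) = q v - q' u]
   for odd [k]; likewise for the turned box. *)
Let corner1 : exists a0 b0 : int, px q q' a0 b0 = 0 /\ py e e' a0 b0 = Q0.
Proof.
rewrite /Q0; case: (odd k).
  exists (- qI'), qI; rewrite /px /py intrN -/q -/q'; split; first by ring.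
  by rewrite -covol; ring.
by exists 0, 0; rewrite /px /py !mulr0z; split; ring.
Qed.

Let corner2 : exists a0 b0 : int, px e' e a0 b0 = - Q1 /\ py q' q a0 b0 = 0.
Proof.
rewrite /Q1 /Q0; case: (odd k).
  by exists 0, 0; rewrite /px /py addNr oppr0 !mulr0z; split; ring.
exists (- qI), (- qI'); rewrite /px /py !intrN -/q -/q'; split; last by ring.
by rewrite add0r -covol; ring.
Qed.

Let FG' x j : (G x + F j <= n + j * x)%N.
Proof. by rewrite addnC mulnC. Qed.

Let steep1 : (Q1 - Q0) * q < (n%:R - 0) * e.
Proof. by rewrite /Q1 addrAC subrr add0r mul1r subr0. Qed.

Let steep2 : (n%:R - 0) * e' < (- Q0 - - Q1) * q'.
Proof.
have -> : - Q0 - - Q1 = 1 by rewrite /Q1; ring.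
by rewrite mul1r subr0.
Qed.

Let colU (X y : nat) : X%:R <= x0 -> cell X y ->
  y.+1%:R <= y0 + 2 * q * e * (x0 - X%:R) + 1.
Proof.
move=> /good_x hX c; have [a0 [b0 [h1 h2]]] := corner1; rewrite -width1E.
exact: (column_upper q_gt0 q_le e'_gt0 (ltW e_gt) covol skew (upper_le _)
  (upper_lt _) h1 h2 steep1 box1_in box1_onto coord_inj FG F_in fam1 fam1' hX c).
Qed.

Let colL (X y : nat) : (0 < X)%N -> X%:R <= x0 ->
  y.+1%:R <= y0 + 2 * q * e * (x0 - X%:R) - 1 \/ y = 0%N -> cell X.-1 y.
Proof.
move=> X0 /good_x hX; have [a0 [b0 [h1 h2]]] := corner1; rewrite -width1E.
exact: (column_lower q_gt0 q_le e'_gt0 (ltW e_gt) covol skew (upper_le _)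
  (upper_lt _) h1 h2 steep1 box1_in box1_onto coord_inj FG F_out fam1 fam1' hX X0).
Qed.

Let covol' : e * q' + e' * q = 1. Proof. by rewrite mulrC (mulrC e'). Qed.
Let skew' : e' * q < e * q'. Proof. by rewrite mulrC (mulrC e). Qed.

Let rowU (Y x : nat) : Y%:R <= y0 -> cell x Y ->
  x.+1%:R <= x0 + 2 * e' * q' * (y0 - Y%:R) + 1.
Proof.
move=> /good_y hY c; have [a0 [b0 [h1 h2]]] := corner2; rewrite -height1E.
exact: (column_upper (cell := fun y x => cell x y) e'_gt0 (ltW e_gt) q_gt0 q_le
  covol' skew' (upper_lt _) (upper_le _) h1 h2 steep2 box2_in box2_onto coord_inj2
  FG' (fun y x => @G_in x y) fam2 fam2' hY c).
Qed.

Let rowL (Y x : nat) : (0 < Y)%N -> Y%:R <= y0 ->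
  x.+1%:R <= x0 + 2 * e' * q' * (y0 - Y%:R) - 1 \/ x = 0%N -> cell x Y.-1.
Proof.
move=> Y0 /good_y hY; have [a0 [b0 [h1 h2]]] := corner2; rewrite -height1E.
exact: (column_lower (cell := fun y x => cell x y) e'_gt0 (ltW e_gt) q_gt0 q_le
  covol' skew' (upper_lt _) (upper_le _) h1 h2 steep2 box2_in box2_onto coord_inj2
  FG' (fun y x => @G_out x y) fam2 fam2' hY Y0).
Qed.

Let slope1_le : 0 <= 2 * q * e <= 2.
Proof.
have h : q * e <= q' * e by rewrite ler_pM2r.
have h2 : 0 < q * e' by rewrite mulr_gt0.
have h3 : 0 < q * e by rewrite mulr_gt0.
have h4 := covol; apply/andP; split; lra.
Qed.

Let slope2_le : 0 <= 2 * e' * q' <= 2.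
Proof.
have h : e' * q' <= e * q' by rewrite ler_pM2r // ltW.
have h2 : 0 < q * e' by rewrite mulr_gt0.
have h3 : 0 < e' * q' by rewrite mulr_gt0.
have h4 := covol; apply/andP; split; lra.
Qed.

Let shape_near_left (x : R) : 0 <= x <= x0 ->
  let w := q + n%:R * e - 2 * x * q * e in
  (exists X Y : nat,
     [/\ cell X Y, `|x - X.+1%:R| <= 1 & `|w - Y.+1%:R| <= 4]) /\
  (exists X Y : nat,
     [/\ ~~ cell X Y, `|x - (X%:R + 2^-1)| <= 1 & `|w - (Y%:R + 2^-1)| <= 4]).
Proof.
move=> hx /=; rewrite -widthE; have /andP[m0 m2] := slope1_le; split.
  apply: (near_cell m0 m2 x0_gt0 y0_gt0) => // Y Y0 hY.
  by apply: rowL => //; right.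
exact: (near_hole m0 m2 x0_gt0 y0_gt0).
Qed.

Let shape_near_right (y : R) : 0 <= y <= y0 ->
  let w := q' + n%:R * e' - 2 * y * q' * e' in
  (exists X Y : nat,
     [/\ cell X Y, `|w - X.+1%:R| <= 4 & `|y - Y.+1%:R| <= 1]) /\
  (exists X Y : nat,
     [/\ ~~ cell X Y, `|w - (X%:R + 2^-1)| <= 4 & `|y - (Y%:R + 2^-1)| <= 1]).
Proof.
move=> hy /=.
have -> : q' + n%:R * e' - 2 * y * q' * e' = x0 + 2 * e' * q' * (y0 - y).
  have := height1E 0; rewrite subr0 mulr0 !mul0r !subr0 => h.
  rewrite mulrBr addrA -h (_ : - Q0 - - Q1 = 1); last by rewrite /Q1; ring.
  ring.
have /andP[m0 m2] := slope2_le; pose tcell y x := cell x y.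
have tL (Y x : nat) : (0 < Y)%N -> Y%:R <= y0 ->
    x.+1%:R <= x0 + 2 * e' * q' * (y0 - Y%:R) - 1 \/ x = 0%N -> tcell Y.-1 x.
  exact: rowL.
have tU (Y x : nat) : Y%:R <= y0 -> tcell Y x ->
    x.+1%:R <= x0 + 2 * e' * q' * (y0 - Y%:R) + 1.
  exact: rowU.
split.
  have tcol (X : nat) : (0 < X)%N -> X%:R <= x0 -> tcell 0 X.-1.
    by move=> X0 hX; apply: colL => //; right.
  have [Y [X [c h1 h2]]] := near_cell m0 m2 y0_gt0 x0_gt0 tL tcol cell00 hy.
  by exists X, Y.
have [Y [X [c h1 h2]]] := near_hole m0 m2 y0_gt0 x0_gt0 tU hy.
by exists X, Y.
Qed.

Lemma shape_near :
  (forall x : R, 0 <= x <= x0 ->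
    let w := q + n%:R * e - 2 * x * q * e in
    (exists X Y : nat,
       [/\ cell X Y, `|x - X.+1%:R| <= 1 & `|w - Y.+1%:R| <= 4]) /\
    (exists X Y : nat,
       [/\ ~~ cell X Y, `|x - (X%:R + 2^-1)| <= 1 & `|w - (Y%:R + 2^-1)| <= 4])) /\
  (forall y : R, 0 <= y <= y0 ->
    let w := q' + n%:R * e' - 2 * y * q' * e' in
    (exists X Y : nat,
       [/\ cell X Y, `|w - X.+1%:R| <= 4 & `|y - Y.+1%:R| <= 1]) /\
    (exists X Y : nat,
       [/\ ~~ cell X Y, `|w - (X%:R + 2^-1)| <= 4 & `|y - (Y%:R + 2^-1)| <= 1])).
Proof. by split; [exact: shape_near_left|exact: shape_near_right]. Qed.

End Shape.

(** * The shape of the permutation w(n, alpha) *)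
Section KroneckerShape.
Variables (R : realType) (alpha : R) (n : nat).
Hypotheses (alpha01 : 0 < alpha < 1) (alpha_irr : irrational alpha) (n_gt0 : (0 < n)%N).

Let la := sh (kronecker_perm n alpha).
Let cell x y := (x < nth 0 la y)%N.

Let la_sorted : sorted geq la.
Proof. by have [] := shape_sorting_perm n (frac_mul alpha). Qed.

Let la_sum : sumn la = n.
Proof. by have [] := shape_sorting_perm n (frac_mul alpha). Qed.

Let cell00 : cell 0 0.
Proof.
rewrite /cell cellE // -has_count; apply: contraT => /hasPn h.
move: n_gt0; rewrite -la_sum lt0n => /eqP; case.
elim: (la) h => [//|l s IH] h /=; rewrite IH => [|z zs]; last first.
  by apply: h; rewrite inE zs orbT.
by have := h l; rewrite inE eqxx -leqNgt leqn0 => /(_ isT)/eqP->.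
Qed.

Let duality x j : (colsum la x + rowsum la j <= n + j * x)%N.
Proof. by have := colsum_rowsum la x j; rewrite la_sum. Qed.

Let col_in x y : cell x y -> (colsum la x + y.+1 <= colsum la x.+1)%N.
Proof. by rewrite /cell cellE // colsumS leq_add2l. Qed.

Let col_out x y : ~~ cell x y -> (colsum la x.+1 <= colsum la x + y)%N.
Proof. by rewrite /cell cellE // colsumS leq_add2l -leqNgt. Qed.

Let row_in x y : cell x y -> (rowsum la y + x.+1 <= rowsum la y.+1)%N.
Proof. by rewrite rowsumS leq_add2l. Qed.

Let row_out x y : ~~ cell x y -> (rowsum la y.+1 <= rowsum la y + x)%N.
Proof. by rewrite rowsumS leq_add2l -leqNgt. Qed.

Let fam_inc j (c : nat -> nat) :
  (forall a b, (0 < a)%N -> (a < b <= n)%N -> c a = c b -> (c a < j)%N ->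
     frac_mul alpha a < frac_mul alpha b) ->
  (count (fun a => c a < j) (iota 1 n) <= rowsum la j)%N.
Proof.
by apply: sorting_perm_increasing => a b _ _; apply: frac_mul_inj.
Qed.

Let fam_dec j (c : nat -> nat) :
  (forall a b, (0 < a)%N -> (a < b <= n)%N -> c a = c b -> (c a < j)%N ->
     frac_mul alpha b < frac_mul alpha a) ->
  (count (fun a => c a < j) (iota 1 n) <= colsum la j)%N.
Proof.
by apply: sorting_perm_decreasing => a b _ _; apply: frac_mul_inj.
Qed.

Lemma conv_err_gt0 k : 0 < conv_err alpha k.
Proof.
have q_gt0 : 0 < (conv_den alpha k)%:~R :> R.
  by have [h _ _ _ _] := convergent_pair alpha01 alpha_irr k; apply: lt_le_trans h.
rewrite -(pmulr_rgt0 _ q_gt0) (conv_errE alpha01 alpha_irr).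
have := signed_err_pos alpha01 alpha_irr k.
by rewrite /signed_err -(conv_numE alpha_irr) -(conv_denE alpha_irr).
Qed.

Lemma lt_beta k : n%:R < conv_beta alpha k ->
  n%:R * ((conv_den alpha k)%:~R * conv_err alpha k) < (conv_den alpha k)%:~R.
Proof.
have q_gt0 : 0 < (conv_den alpha k)%:~R :> R.
  by have [h _ _ _ _] := convergent_pair alpha01 alpha_irr k; apply: lt_le_trans h.
rewrite /conv_beta -[X in _ < X -> _]mul1r ltr_pdivlMr ?conv_err_gt0 // => h.
by rewrite mulrCA -[ltRHS]mulr1 ltr_pM2l.
Qed.

(** Equality is excluded because [alpha] is irrational. *)
Lemma ge_beta k : conv_beta alpha k <= n%:R ->
  (conv_den alpha k)%:~R < n%:R * ((conv_den alpha k)%:~R * conv_err alpha k).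
Proof.
have q_gt0 : 0 < (conv_den alpha k)%:~R :> R.
  by have [h _ _ _ _] := convergent_pair alpha01 alpha_irr k; apply: lt_le_trans h.
rewrite /conv_beta -[X in X <= _ -> _]mul1r ler_pdivrMr ?conv_err_gt0 // => h.
rewrite lt_neqAle; apply/andP; split; last first.
  by rewrite mulrCA -[leLHS]mulr1 ler_pM2l.
rewrite (conv_errE alpha01 alpha_irr); apply/negP => /eqP E.
have nq : n%:Z * conv_den alpha k != 0.
  by rewrite mulf_neq0 ?eqz_nat -?lt0n // -(intr_eq0 R) gt_eqF.
have := irrational_linear alpha_irr
  (n%:Z * conv_num alpha k + (-1) ^+ k * conv_den alpha k) nq.
rewrite intrD !intrM rmorphXn /= intrN mulr1z => /eqP; apply.
have ss : (-1) ^+ k * (-1) ^+ k = 1 :> R by rewrite -expr2 sqrr_sign.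
have -> : (n%:Z)%:~R = n%:R :> R by [].
move: E ss; set s := (-1) ^+ k; set q := (conv_den _ _)%:~R.
set p := (conv_num _ _)%:~R => E ss.
have sq : s * q = n%:R * (alpha * q - p).
  by rewrite {1}E -[RHS]mul1r -ss; ring.
by rewrite sq; ring.
Qed.

Section Regime.
Variable k : nat.
Let q : R := (conv_den alpha k)%:~R.
Let q' : R := (conv_den alpha k.+1)%:~R.
Let d : R := conv_err alpha k.
Let d' : R := conv_err alpha k.+1.
Hypotheses (n_lb : conv_beta alpha k <= n%:R) (n_ub : n%:R < conv_beta alpha k.+1).

Let x0 : R := (q' - n%:R * (q' * d')) / (q' * (q * d) - q * (q' * d')).
Let y0 : R := (n%:R * (q * d) - q) / (q' * (q * d) - q * (q' * d')).

Let near (P : R * R) : Prop :=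
  (dist_to P (planar_boundary la) < 8%:E)%E.

Let near_of (P : R * R) (X Y X' Y' : nat) (d1 d2 : R) :
  cell X Y -> ~~ cell X' Y' ->
  `|P.1 - X.+1%:R| <= d1 -> `|P.2 - Y.+1%:R| <= d2 ->
  `|P.1 - (X'%:R + 2^-1)| <= d1 -> `|P.2 - (Y'%:R + 2^-1)| <= d2 ->
  d1 ^+ 2 + d2 ^+ 2 < 8 ^+ 2 -> near P.
Proof.
move=> c c' h1 h2 h3 h4 h5.
exact: (dist_to_boundary_lt la_sorted c c' h1 h2 h3 h4 _ h5).
Qed.

Let b14 : 1 ^+ 2 + 4 ^+ 2 < 8 ^+ 2 :> R. Proof. by rewrite expr1n !expr2; lra. Qed.
Let b41 : 4 ^+ 2 + 1 ^+ 2 < 8 ^+ 2 :> R. Proof. by rewrite addrC b14. Qed.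

Let sgn_even : ~~ odd k -> ((-1) ^+ k : int)%:~R = 1 :> R.
Proof. by move=> ek; rewrite -signr_odd (negbTE ek). Qed.

Let sgn_odd : odd k -> ((-1) ^+ k : int)%:~R = -1 :> R.
Proof. by move=> ek; rewrite -signr_odd ek expr1 intrN. Qed.

Lemma near_even : ~~ odd k ->
  (forall x, 0 <= x <= x0 -> near (x, q + n%:R * (q * d) - 2 * x * q * (q * d))) /\
  (forall y, 0 <= y <= y0 -> near (q' + n%:R * (q' * d') - 2 * y * q' * (q' * d'), y)).
Proof.
move=> ek; have sE (a : R) : ((-1) ^+ k : int)%:~R * a = a by rewrite sgn_even ?mul1r.
have famF j (c : nat -> nat) : (forall a b, (0 < a)%N -> (a < b <= n)%N -> c a = c b ->
    (c a < j)%N -> ((-1) ^+ k : int)%:~R * frac_mul alpha b <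
       ((-1) ^+ k : int)%:~R * frac_mul alpha a) ->
    (count (fun a => c a < j) (iota 1 n) <= colsum la j)%N.
  move=> H; apply: fam_dec => a b a0 ab cab ca.
  by have := H a b a0 ab cab ca; rewrite !sE.
have famG j (c : nat -> nat) : (forall a b, (0 < a)%N -> (a < b <= n)%N -> c a = c b ->
    (c a < j)%N -> ((-1) ^+ k : int)%:~R * frac_mul alpha a <
       ((-1) ^+ k : int)%:~R * frac_mul alpha b) ->
    (count (fun a => c a < j) (iota 1 n) <= rowsum la j)%N.
  move=> H; apply: fam_inc => a b a0 ab cab ca.
  by have := H a b a0 ab cab ca; rewrite !sE.
have [H1 H2] := shape_near alpha01 alpha_irr (ge_beta n_lb) (lt_beta n_ub)
  duality col_in col_out row_in row_out famF famG cell00.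
split=> [x /H1|y /H2] [[X [Y [c h1 h2]]] [X' [Y' [c' h3 h4]]]].
  apply: near_of c c' _ _ _ _ b14; assumption.
apply: near_of c c' _ _ _ _ b41; assumption.
Qed.

(** Flipping the vertical axis exchanges increasing and decreasing sequences,
    and with them rows and columns. *)
Lemma near_odd : odd k ->
  (forall x, 0 <= x <= x0 -> near (q + n%:R * (q * d) - 2 * x * q * (q * d), x)) /\
  (forall y, 0 <= y <= y0 -> near (y, q' + n%:R * (q' * d') - 2 * y * q' * (q' * d'))).
Proof.
move=> ok; have sE (a : R) : ((-1) ^+ k : int)%:~R * a = - a by rewrite sgn_odd ?mulN1r.
have famF j (c : nat -> nat) : (forall a b, (0 < a)%N -> (a < b <= n)%N -> c a = c b ->
    (c a < j)%N -> ((-1) ^+ k : int)%:~R * frac_mul alpha b <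
       ((-1) ^+ k : int)%:~R * frac_mul alpha a) ->
    (count (fun a => c a < j) (iota 1 n) <= rowsum la j)%N.
  move=> H; apply: fam_inc => a b a0 ab cab ca.
  by have := H a b a0 ab cab ca; rewrite !sE ltrN2.
have famG j (c : nat -> nat) : (forall a b, (0 < a)%N -> (a < b <= n)%N -> c a = c b ->
    (c a < j)%N -> ((-1) ^+ k : int)%:~R * frac_mul alpha a <
       ((-1) ^+ k : int)%:~R * frac_mul alpha b) ->
    (count (fun a => c a < j) (iota 1 n) <= colsum la j)%N.
  move=> H; apply: fam_dec => a b a0 ab cab ca.
  by have := H a b a0 ab cab ca; rewrite !sE ltrN2.
have duality' x j : (rowsum la x + colsum la j <= n + j * x)%N.
  by rewrite addnC mulnC.
have [H1 H2] := shape_near (cell := fun x y => cell y x) alpha01 alpha_irr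
  (ge_beta n_lb) (lt_beta n_ub) duality' (fun x y => @row_in y x)
  (fun x y => @row_out y x) (fun x y => @col_in y x) (fun x y => @col_out y x)
  famF famG cell00.
split=> [x /H1|y /H2] [[Y [X [c h1 h2]]] [Y' [X' [c' h3 h4]]]].
  apply: near_of c c' _ _ _ _ b41; assumption.
apply: near_of c c' _ _ _ _ b14; assumption.
Qed.

End Regime.

End KroneckerShape.

(** The second piece of [L] is the row estimate solved for the row: the point of
    abscissa [x] is the one of ordinate [(a - x) / m] on [x = a - m y]. *)
Lemma second_branch (R : realType) (a m x t0 s0 : R) : 0 < m ->
  s0 + m * t0 = a -> s0 <= x <= a ->
  0 <= (a - x) / m <= t0 /\ x = a - m * ((a - x) / m).
Proof.
move=> m0 ea /andP[sx xa]; split; last by rewrite mulrCA divff ?gt_eqF // mulr1; ring.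
rewrite divr_ge0 ?subr_ge0 ?(ltW m0) //= ler_pdivrMr // mulrC; lra.
Qed.

Theorem theorem6 (R : realType) (alpha : R) (n h : nat) :
  0 < alpha < 1 ->
  irrational alpha ->
  (0 < n)%N ->
  alpha^-1 < n%:R ->
  (1 - alpha)^-1 < n%:R ->
  conv_beta alpha (2 * h) <= n%:R < conv_beta alpha (2 * h + 2) ->
  forall x : R, 0 <= x <= x_max n alpha h ->
    (dist_to (x, L_fun n alpha h x)
       (planar_boundary (sh (kronecker_perm n alpha))) < 8%:E)%E.
Proof.
move=> alpha01 irr n0 _ _ /andP[beta_e beta_e'] x /andP[x_ge0 x_le].
pose q k : R := (conv_den alpha k)%:~R; pose d k := conv_err alpha k.
have q_gt0 k : 0 < q k.
  by have [hq _ _ _ _] := convergent_pair alpha01 irr k; apply: lt_le_trans hq.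
have d_gt0 k : 0 < d k := conv_err_gt0 alpha01 irr k.
have covol k : q k.+1 * (q k * d k) + q k * (q k.+1 * d k.+1) = 1.
  by have [] := convergent_pair alpha01 irr k.
have skew k : 0 < q k.+1 * (q k * d k) - q k * (q k.+1 * d k.+1).
  have [_ hq _ he _] := convergent_pair alpha01 irr k; rewrite subr_gt0.
  apply: le_lt_trans (_ : q k.+1 * (q k.+1 * d k.+1) < _); last by rewrite ltr_pM2l.
  by rewrite ler_wpM2r // ltW // mulr_gt0.
have m_gt0 k : 0 < 2 * q k ^+ 2 * d k by rewrite !mulr_gt0 ?exprn_gt0.
pose x0 k := (q k.+1 - n%:R * (q k.+1 * d k.+1)) /
  (q k.+1 * (q k * d k) - q k * (q k.+1 * d k.+1)).
pose y0 k := (n%:R * (q k * d k) - q k) /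
  (q k.+1 * (q k * d k) - q k * (q k.+1 * d k.+1)).
have x0E k : x0 k = (1 - n%:R * d k.+1) / (q k * (d k - d k.+1)).
  rewrite /x0 (_ : q k.+1 - _ = q k.+1 * (1 - n%:R * d k.+1)); last by ring.
  rewrite (_ : q k.+1 * _ - _ = q k.+1 * (q k * (d k - d k.+1))); last by ring.
  by rewrite -mulf_div divff ?mul1r // gt_eqF.
have y0E k : y0 k = (1 - n%:R * d k) / (q k.+1 * (d k.+1 - d k)).
  rewrite /y0 (_ : _ - q k = - q k * (1 - n%:R * d k)); last by ring.
  rewrite (_ : q k.+1 * _ - _ = - q k * (q k.+1 * (d k.+1 - d k))); last by ring.
  by rewrite -mulf_div divff ?mul1r // oppr_eq0 gt_eqF.
have x0D k : x0 k * (q k.+1 * (q k * d k) - q k * (q k.+1 * d k.+1)) =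
  q k.+1 - n%:R * (q k.+1 * d k.+1) by rewrite /x0 divfK // lt0r_neq0.
have y0D k : y0 k * (q k.+1 * (q k * d k) - q k * (q k.+1 * d k.+1)) =
  n%:R * (q k * d k) - q k by rewrite /y0 divfK // lt0r_neq0.
have x0y0 k : x0 k + 2 * q k.+1 ^+ 2 * d k.+1 * y0 k = q k.+1 * (1 + n%:R * d k.+1).
  apply: (mulIf (lt0r_neq0 (skew k))).
  rewrite mulrDl -(mulrA (2 * q k.+1 ^+ 2 * d k.+1)) x0D y0D; have := covol k.
  move: (q k) (q k.+1) (d k) (d k.+1) (n%:R) => a b u v m c.
  transitivity ((b - m * (b * v)) * (b * (a * u) + a * (b * v)) +
    2 * b ^+ 2 * v * (m * (a * u) - a)); first by rewrite c mulr1.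
  ring.
have y0x0 k : y0 k + 2 * q k ^+ 2 * d k * x0 k = q k * (1 + n%:R * d k).
  apply: (mulIf (lt0r_neq0 (skew k))).
  rewrite mulrDl -(mulrA (2 * q k ^+ 2 * d k)) x0D y0D; have := covol k.
  move: (q k) (q k.+1) (d k) (d k.+1) (n%:R) => a b u v m c.
  transitivity ((m * (a * u) - a) * (b * (a * u) + a * (b * v)) +
    2 * a ^+ 2 * u * (b - m * (b * v))); first by rewrite c mulr1.
  ring.
(* For [n < beta_(2h+1)] the pair of convergents is [2h, 2h+1] and the first
   piece of [L] estimates columns; otherwise it is [2h+1, 2h+2], which is flipped,
   and the first piece comes from its second vector. *)
move: x_le; rewrite /L_fun /x_break /x_max /even_index.
case: (ltP n%:R _) => [n_lt|n_ge].
  have odd_h : ~~ odd (2 * h) by rewrite oddM.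
  rewrite addn0 addn1 in n_lt *; rewrite -!/(q _) -!/(d _) -x0E => x_le.
  have [H1 H2] := near_even alpha01 irr n0 beta_e n_lt odd_h.
  case: (leP x) => hx.
    have := H1 x; rewrite x_ge0 hx => /(_ isT); congr ((dist_to (_, _) _ < _)%E).
    by rewrite -!/(q _) -!/(d _); ring.
  have [hy ex] := second_branch (m_gt0 _) (x0y0 _) (introT andP (conj (ltW hx) x_le)).
  have := H2 _ hy; congr ((dist_to (_, _) _ < _)%E).
  by rewrite [RHS]ex -!/(q _) -!/(d _); ring.
have odd_h : odd (2 * h).+1 by rewrite /= oddM.
rewrite addn1 addn2 in n_ge beta_e' *; rewrite -!/(q _) -!/(d _) -y0E => x_le.
have [H1 H2] := near_odd alpha01 irr n0 n_ge beta_e' odd_h.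
case: (leP x) => hx.
  have := H2 x; rewrite x_ge0 hx => /(_ isT); congr ((dist_to (_, _) _ < _)%E).
  by rewrite -!/(q _) -!/(d _); ring.
have [hy ex] := second_branch (m_gt0 _) (y0x0 _) (introT andP (conj (ltW hx) x_le)).
have := H1 _ hy; congr ((dist_to (_, _) _ < _)%E).
by rewrite [RHS]ex -!/(q _) -!/(d _); ring.
Qed.
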